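(* The graph $\mathcal{S}_{2k+1}$ is DS if $k\notin S$, where $$S=\{4\ell+3\mid\ell\in\mathbb{N}\}\cup\{\ell^2-1\mid\ell\in\mathbb{N}\}\cup\{\ell^2-\ell\mid\ell\in\mathbb{N}\}\cup\{14,17\}.$$ Moreover, for $k\in S$ we have: (a) $\mathcal{S}_{17}$ has exactly two cospectral mates, which are $\mathcal{L}_{4,4}\cup4K_2\cup K_1$ and $G_1\cup3K_2\cup K_1$; (b) $\mathcal{S}_{29}$ has exactly one cospectral mate, which is $G_4\cup9K_2$; (c) $\mathcal{S}_{31}$ has exactly four cospectral mates, which are $G_2\cup9K_2\cup K_1$, $\mathcal{L}_{5,5}\cup10K_2\cup K_1$, $\mathcal{R}_{13}\cup9K_2$, and $\mathcal{Q}_{13}\cup9K_2$; (d) $\mathcal{S}_{35}$ has exactly one cospectral mate, which is $G_3\cup12K_2$; (e) if $k=4\ell+3$ and $\ell$ is not an integer of the form $t^2-1$, then $\mathcal{S}_{2k+1}$ has exactly two cospectral mates, which are $\mathcal{R}_{2\ell+7}\cup3\ell K_2$ and $\mathcal{Q}_{2\ell+7}\cup3\ell K_2$; (f) if $k=\ell^2-1$, $\ell=2t$, and $k\ne15$, then $\mathcal{S}_{2k+1}$ has exactly three cospectral mates, which are $\mathcal{L}_{\ell+1,\ell+1}\cup(k-\ell-1)K_2\cup K_1$, $\mathcal{R}_{2t^2+5}\cup3(t^2-1)K_2$, and $\mathcal{Q}_{2t^2+5}\cup3(t^2-1)K_2$; (g) if $k=\ell^2-1$, $\ell$ is odd, and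 $k\ne8$, then $\mathcal{S}_{2k+1}$ has exactly one cospectral mate, which is $\mathcal{L}_{\ell+1,\ell+1}\cup(k-\ell-1)K_2\cup K_1$; (h) if $k=\ell^2-\ell$, then $\mathcal{S}_{2k+1}$ has exactly one cospectral mate, which is $\mathcal{H}_{\ell,\ell+1}\cup(k-\ell)K_2$.
   Context: Graphs are finite, simple and undirected; the spectrum of a graph is the multiset of eigenvalues of its adjacency matrix. A cospectral mate of $G$ is a graph with the same spectrum as $G$ that is not isomorphic to $G$ (counted up to isomorphism); $G$ is DS if it has no cospectral mate. $\cup$ denotes disjoint union and $mK_2$ denotes $m$ disjoint copies of $K_2$. Here $k$ is a positive integer and $\ell,t\in\mathbb{N}$. A matrix $N$ is the bipartite adjacency matrix of a bipartite graph $G$ if the adjacency matrix of $G$ can be arranged as $\begin{pmatrix}O&N\\N^\top&O\end{pmatrix}$ with square zero blocks. $J$ denotes an all-ones matrix of appropriate size ($J_{r,\ell}$ if $r\times\ell$, $J_r$ if $r\times r$), $\mathbf 1$ an all-ones column, $I_\ell$ the identity, and $\widetilde{I_\ell}=(I_\ell\ \ \mathbf 1_\ell)$ the $\ell\times(\ell+1)$ matrix obtained by appending an all-ones column to $I_\ell$. $\mathcal{S}_{2k+1}$ is the subdivision of the star $K_{1,k}$ (a new vertex is inserted on every edge). $\mathcal{L}_{k,k}$ is $K_{k,k}$ minus a perfect matching. $\mathcal{H}_{k,k+1}$ is obtained from $\mathcal{L}_{k,k}$ by adding a new vertex joined to all vertices of one part. For $n=2m+1$ with $m\ge3$, $\mathcal{R}_n$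 and $\mathcal{Q}_n$ are the bipartite graphs with $m\times(m+1)$ bipartite adjacency matrices $$\begin{pmatrix}I_{m-3}&J\\O&\widetilde{I_3}\end{pmatrix},\qquad \begin{pmatrix}\widetilde{I_{m-3}}&J\\O&J_3-I_3\end{pmatrix},$$ respectively. $G_1$ (order 10), $G_2$ (order 12), $G_3$ (order 11), $G_4$ (order 11) are the bipartite graphs with bipartite adjacency matrices $$\begin{pmatrix}1&\mathbf 1^\top\\\mathbf 1&I_4\end{pmatrix},\quad\begin{pmatrix}J_3-I_3&J_3\\O&J_3-I_3\end{pmatrix},\quad\begin{pmatrix}J_4-I_4&J_{4,2}\\O&J_{1,2}\end{pmatrix},\quad\begin{pmatrix}J_3-I_3&J_{3,3}\\O&\widetilde{I_2}\end{pmatrix},$$ respectively.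
   Formalization: In (f) the case k=3 is excluded, since R_7 is S_7 and Q_7 is L_{3,3}∪K_1; instead S_7 has exactly one mate, L_{3,3}∪K_1. In (h) the case k=2 is excluded, since H_{2,3} is S_5; instead S_5 is DS. *)

(* Defs.v *)
From mathcomp Require Import all_boot all_order all_algebra all_field.
Set Implicit Arguments.
Unset Strict Implicit.
Unset Printing Implicit Defensive.
Import GRing.Theory.

Record sgraph := SGraph {
  vertex :> finType;
  adj : rel vertex;
  adj_sym : symmetric adj;
  adj_irr : irreflexive adj }.

Definition giso (G H : sgraph) : Prop :=
  exists2 f : G -> H, bijective f & forall x y, adj (f x) (f y) = adj x y.

Definition adjmx (G : sgraph) : 'M[algC]_#|G| :=
  (\matrix_(i, j) (adj (enum_val i) (enum_val j))%:R)%R.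

(* The roots of the characteristic polynomial, listed with multiplicity; the
   order of the list is irrelevant. An adjacency matrix has integer entries, so
   all its eigenvalues lie in algC. *)
Definition spectrum (G : sgraph) : seq algC :=
  sval (closed_field_poly_normal (char_poly (adjmx G))).

Definition cospectral (G H : sgraph) : Prop :=
  perm_eq (spectrum G) (spectrum H).

Definition mate (G H : sgraph) : Prop := cospectral G H /\ ~ giso H G.

Definition DS (G : sgraph) : Prop := ~ exists H : sgraph, mate G H.

(* Up to isomorphism G has exactly [size Hs] cospectral mates, namely the
   (pairwise non-isomorphic) members of Hs. *)
Definition exact_mates (G : sgraph) (Hs : seq sgraph) : Prop :=
  [/\ forall i, i < size Hs -> mate G (nth G Hs i),
      forall i j, i < j -> j < size Hs -> ~ giso (nth G Hs i) (nth G Hs j)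
    & forall H, mate G H -> exists2 i, i < size Hs & giso H (nth G Hs i)].

Definition bip_rel (A B : Type) (r : A -> B -> bool) : rel (A + B) :=
  fun u v => match u, v with
             | inl a, inr b | inr b, inl a => r a b
             | _, _ => false
             end.

Lemma bip_rel_sym A B (r : A -> B -> bool) : symmetric (bip_rel r).
Proof. by case=> ? [] ?. Qed.

Lemma bip_rel_irr A B (r : A -> B -> bool) : irreflexive (bip_rel r).
Proof. by case. Qed.

Definition bip_graph (A B : finType) (r : A -> B -> bool) : sgraph :=
  SGraph (bip_rel_sym r) (bip_rel_irr r).

(* The bipartite graph with bipartite adjacency matrix N (a 0/1 matrix): with
   the row vertices listed first, its adjacency matrix is (O N; N^T O). *)
Definition bip_of_mx m n (N : 'M[int]_(m, n)) : sgraph :=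
  bip_graph (fun (i : 'I_m) (j : 'I_n) => N i j == 1%R).

Definition union_rel (A B : Type) (r : rel A) (s : rel B) : rel (A + B) :=
  fun u v => match u, v with
             | inl a, inl a' => r a a'
             | inr b, inr b' => s b b'
             | _, _ => false
             end.

Lemma union_rel_sym A B (r : rel A) (s : rel B) :
  symmetric r -> symmetric s -> symmetric (union_rel r s).
Proof. by move=> rS sS [a|b] [a'|b'] //=. Qed.

Lemma union_rel_irr A B (r : rel A) (s : rel B) :
  irreflexive r -> irreflexive s -> irreflexive (union_rel r s).
Proof. by move=> rI sI [a|b] /=. Qed.

Definition gunion (G H : sgraph) : sgraph :=
  SGraph (union_rel_sym (@adj_sym G) (@adj_sym H))
         (union_rel_irr (@adj_irr G) (@adj_irr H)).

Notation "G \cup H" := (gunion G H) (at level 50, left associativity).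

Definition copies_rel m (T : Type) (r : rel T) : rel ('I_m * T) :=
  fun u v => (u.1 == v.1) && r u.2 v.2.

Lemma copies_rel_sym m T (r : rel T) :
  symmetric r -> symmetric (@copies_rel m T r).
Proof. by move=> rS u v; rewrite /copies_rel eq_sym rS. Qed.

Lemma copies_rel_irr m T (r : rel T) :
  irreflexive r -> irreflexive (@copies_rel m T r).
Proof. by move=> rI u; rewrite /copies_rel rI andbF. Qed.

Definition copies m (G : sgraph) : sgraph :=
  SGraph (@copies_rel_sym m _ _ (@adj_sym G))
         (@copies_rel_irr m _ _ (@adj_irr G)).

Lemma neq_sym (T : eqType) : symmetric (fun x y : T => x != y).
Proof. by move=> x y; rewrite eq_sym. Qed.

Lemma neq_irr (T : eqType) : irreflexive (fun x y : T => x != y).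
Proof. by move=> x; rewrite eqxx. Qed.

Definition complete n : sgraph := SGraph (@neq_sym 'I_n) (@neq_irr 'I_n).

Definition K1 : sgraph := complete 1.
Definition mK2 m : sgraph := copies m (complete 2).

Definition complete_bip m n : sgraph :=
  bip_graph (fun (_ : 'I_m) (_ : 'I_n) => true).

Definition edge (G : sgraph) : finType :=
  {e : {set G} | [exists x, exists y, adj x y && (e == [set x; y])]}.

(* Each edge becomes a vertex joined exactly to its two ends. *)
Definition subdivision (G : sgraph) : sgraph :=
  bip_graph (fun (x : G) (e : edge G) => x \in val e).

Definition add_rel (T : Type) (r : rel T) (P : pred T) : rel (option T) :=
  fun u v => match u, v with
             | Some x, Some y => r x y
             | Some x, None | None, Some x => P x
             | None, None => false
             end.

Lemma add_rel_sym T (r : rel T) P : symmetric r -> symmetric (add_rel r P).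
Proof. by move=> rS [x|] [y|] //=. Qed.

Lemma add_rel_irr T (r : rel T) P : irreflexive r -> irreflexive (add_rel r P).
Proof. by move=> rI [x|] /=. Qed.

Definition add_vertex (G : sgraph) (P : pred G) : sgraph :=
  SGraph (add_rel_sym P (@adj_sym G)) (add_rel_irr P (@adj_irr G)).

(* calS, calR and calQ are indexed by their order n, which is odd: n = 2k+1 for
   calS, n = 2m+1 with m >= 3 for calR and calQ, so that n./2 is k, resp. m. *)
Definition calS n : sgraph := subdivision (complete_bip 1 n./2).

(* calL k is L_{k,k}; the removed perfect matching is {inl i, inr i}. *)
Definition calL k : sgraph := bip_graph (fun i j : 'I_k => i != j).

(* calH k is H_{k,k+1}. *)
Definition calH k : sgraph :=
  add_vertex (G := calL k) (fun u : 'I_k + 'I_k => if u is inl _ then true else false).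

Local Open Scope ring_scope.

Definition Jmx m n : 'M[int]_(m, n) := const_mx 1.
Definition Imx n : 'M[int]_n := 1%:M.
Definition Itilde n : 'M[int]_(n, n + 1) := row_mx (Imx n) (Jmx n 1).
Definition JmI n : 'M[int]_n := Jmx n n - Imx n.

Definition calR n : sgraph :=
  let p := (n./2 - 3)%N in
  bip_of_mx (block_mx (Imx p) (Jmx p (3 + 1)) 0 (Itilde 3)).

Definition calQ n : sgraph :=
  let p := (n./2 - 3)%N in
  bip_of_mx (block_mx (Itilde p) (Jmx p 3) 0 (JmI 3)).

Definition G1 : sgraph :=
  bip_of_mx (block_mx (Jmx 1 1) (Jmx 1 4) (Jmx 4 1) (Imx 4)).
Definition G2 : sgraph :=
  bip_of_mx (block_mx (JmI 3) (Jmx 3 3) 0 (JmI 3)).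
Definition G3 : sgraph :=
  bip_of_mx (block_mx (JmI 4) (Jmx 4 2) 0 (Jmx 1 2)).
Definition G4 : sgraph :=
  bip_of_mx (block_mx (JmI 3) (Jmx 3 3) 0 (Itilde 2)).

Local Close Scope ring_scope.

(* Membership of k in S. Only k > 0 matters; truncated subtraction at l = 0
   merely adds the value k = 0, which l = 1 gives as well. *)
Definition exceptional (k : nat) : Prop :=
  [\/ exists l, k = 4 * l + 3,
      exists l, k = l ^ 2 - 1,
      exists l, k = l ^ 2 - l
    | k = 14 \/ k = 17].

(* Main.v *)
(** The spectrum of S_{2k+1} is symmetric about 0, has 0 as a simple eigenvalue
    and otherwise consists of 1, -1 and the simple eigenvalues +-sqrt(k+1). A
    graph with this spectrum has no closed walk of odd length, hence is bipartite, and the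
    simplicity of 0 forces a k x (k+1) bipartite adjacency matrix N for which
    N N^T has the eigenvalue k+1 once and 1 otherwise. Thus N N^T = I + x x^T:
    the rows of N are nonempty sets R_a with
      |R_a /\ R_b|^2 = (|R_a| - 1)(|R_b| - 1)   and   sum_a (|R_a| - 1) = k,
    and conversely these conditions determine the spectrum.

    Singleton rows are components K_2. Two other rows of different sizes have
    1 + x^2 < 1 + y^2 elements and xy <= x^2 + 1 common ones, so x = 1, y = 2:
    their sizes are 2 and 5, and the smaller is contained in the larger. Rows of
    equal size c+1 meet pairwise in c points, so they either share c points or
    are complements of points in a set of size c+2. Since the rows that are not
    singletons cover at most one more point than there are such rows, only a few
    configurations remain; the coincidences among the resulting values of k
    produce the list of mates. *)

Require Import Defs.
From mathcomp Require Import all_boot all_order all_fingroup all_algebra all_field.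
From mathcomp Require Import zify ring.
Set Implicit Arguments.
Unset Strict Implicit.
Unset Printing Implicit Defensive.
Import Order.TTheory GRing.Theory Num.Theory.

(** * Characteristic polynomials of bipartite graphs *)

Local Open Scope ring_scope.

(** All candidates share one format. With k rows and k+1 columns, one column can be attached to each
    row, leaving one over; a pattern then depends only on its kind and on the numbers p and q of big
    and small rows. Row sizes, intersections and degrees become linear expressions in p and q, so
    cospectrality, the list of admissible parameters and non-isomorphism all turn into arithmetic,
    and an isomorphism with a candidate amounts to naming the attached columns and the leftover one.

    Spectra enter only through characteristic polynomials: that of the graph is X times that of N
    N^T evaluated at X^2, so no square root of an eigenvalue is needed.

    Patterns may coincide when p is small; this is the source of the degenerate values k = 2 and k =
    3. *)

Lemma char_poly_reindex (R : comNzRingType) m n (M : 'M[R]_m) (N : 'M[R]_n)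
    (f : 'I_m -> 'I_n) :
  bijective f -> (forall i j, M i j = N (f i) (f j)) ->
  char_poly M = char_poly N.
Proof.
move=> fbij MN; have emn : m = n by have := bij_eq_card fbij; rewrite !card_ord.
case: n / emn in N f fbij MN *.
pose s := perm (bij_inj fbij).
have -> : char_poly M = \det (row_perm s (col_perm s (char_poly_mx N))).
  congr (\det _); apply/matrixP => i j.
  by rewrite !mxE !permE MN (inj_eq (bij_inj fbij)).
(* The same permutation acts on rows and columns, so its sign occurs twice and cancels. *)
rewrite row_permE col_permE !det_mulmx !det_perm odd_permV mulrC -mulrA.
by rewrite -expr2 sqrr_sign mulr1.
Qed.

Lemma giso_char_poly G H :
  giso G H -> char_poly (adjmx G) = char_poly (adjmx H).
Proof.
case=> f fbij fadj.
apply: (char_poly_reindex (f := fun i => enum_rank (f (enum_val i)))).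
  apply: bij_comp (enum_rank_bij _) (bij_comp fbij (enum_val_bij _)).
by move=> i j; rewrite !mxE !enum_rankK fadj.
Qed.

Lemma spectrumE G :
  char_poly (adjmx G) = \prod_(z <- spectrum G) ('X - z%:P).
Proof.
rewrite /spectrum; case: closed_field_poly_normal => s /= {1}->.
by rewrite (monicP (char_poly_monic _)) scale1r.
Qed.

Lemma cospectralE G H :
  cospectral G H <-> char_poly (adjmx G) = char_poly (adjmx H).
Proof.
split=> [GH|eGH]; first by rewrite !spectrumE (perm_big _ GH).
by rewrite /cospectral /spectrum eGH.
Qed.

(** Multiplying the characteristic matrix on the right by the block matrix with rows (X, 0) and (K,
    1), of determinant X^m, clears the lower left block and leaves X^2 - N K and X on the diagonal.
    Keeping the powers of X on both sides allows any order of m and n. *)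
Lemma char_poly_block_anti (R : comNzRingType) m n (N : 'M[R]_(m, n))
    (K : 'M[R]_(n, m)) :
  char_poly (block_mx 0 N K 0) * 'X^m = (char_poly (N *m K) \Po 'X^2) * 'X^n.
Proof.
pose Np := map_mx polyC N; pose Kp := map_mx polyC K.
have -> : char_poly (block_mx 0 N K 0) =
    \det (block_mx 'X%:M (- Np) (- Kp) 'X%:M).
  rewrite /char_poly /char_poly_mx map_block_mx !map_mx0 scalar_mx_block.
  by rewrite opp_block_mx add_block_mx !oppr0 !addr0 !add0r.
have <- : \det (block_mx 'X%:M 0 Kp (1%:M)) = 'X^m :> {poly R}.
  by rewrite det_lblock det1 mulr1 det_scalar.
rewrite -det_mulmx mulmx_block !mulmx0 !mulmx1 !add0r !mul_mx_scalar !mul_scalar_mx.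
rewrite scalerN addNr det_ublock det_scalar; congr (_ * _).
rewrite /char_poly -det_map_mx; congr (\det _); apply/matrixP => i j.
rewrite !mxE rmorphB rmorphMn /= comp_polyX comp_polyC mulrnAr -expr2.
congr (_ + _); rewrite rmorph_sum -sumrN; apply: eq_bigr => l _.
by rewrite !mxE mulNr rmorphM.
Qed.

Definition incmx (A B : finType) (r : A -> B -> bool) : 'M[algC]_(#|A|, #|B|) :=
  \matrix_(i, j) (r (enum_val i) (enum_val j))%:R.

Lemma char_poly_bip (A B : finType) (r : A -> B -> bool) :
  char_poly (adjmx (bip_graph r)) * 'X^#|A| =
    (char_poly (incmx r *m (incmx r)^T) \Po 'X^2) * 'X^#|B|.
Proof.
rewrite -char_poly_block_anti; congr (_ * _).
pose f (i : 'I_#|((A + B)%type : finType)|) : 'I_(#|A| + #|B|) :=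
  match enum_val i with inl a => lshift _ (enum_rank a)
                      | inr b => rshift _ (enum_rank b) end.
apply: (char_poly_reindex (f := f)).
  apply: inj_card_bij; last by rewrite !card_ord card_sum.
  move=> i j; rewrite /f => eij; apply: enum_val_inj.
  case: (enum_val i) (enum_val j) eij => a [] b.
  - by move=> /lshift_inj/enum_rank_inj->.
  - by move=> /eqP; rewrite eq_lrshift.
  - by move=> /eqP; rewrite eq_rlshift.
  - by move=> /rshift_inj/enum_rank_inj->.
move=> i j; rewrite mxE /f; case: (enum_val i) (enum_val j) => a [] b /=.
- by rewrite block_mxEul mxE.
- by rewrite block_mxEur mxE !enum_rankK.
- by rewrite block_mxEdl !mxE !enum_rankK.
- by rewrite block_mxEdr mxE.
Qed.

(** Both sides equal X - 1 times the determinant of the bordered matrix with blocks (X - 1) I, x,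
    x^T and 1. Eliminating with the corner 1 gives the characteristic polynomial, eliminating with
    (X - 1) I gives the right-hand side. The factor X - 1 on the left avoids the exponent n - 1. *)
Lemma char_poly_1_rank1 (R : idomainType) n (x : 'cV[R]_n) :
  char_poly (1%:M + x *m x^T) * ('X - 1) =
    ('X - 1) ^+ n * ('X - 1 - ((x^T *m x) 0 0)%:P).
Proof.
pose c : {poly R} := 'X - 1; pose y := map_mx polyC x.
pose M := block_mx (c%:M : 'M_n) y y^T (1%:M : 'M_1).
have yy : y^T *m y = ((x^T *m x) 0 0)%:P%:M.
  apply/matrixP => i j; rewrite !ord1 !mxE mulr1n rmorph_sum.
  by apply: eq_bigr => l _; rewrite !mxE rmorphM.
have dM : \det M * c = c ^+ n * (c - ((x^T *m x) 0 0)%:P).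
  have dc : \det (block_mx (1%:M : 'M_n) (- y) 0 (c%:M : 'M_1)) = c.
    by rewrite det_ublock det1 mul1r det_scalar expr1.
  rewrite -[X in _ * X = _]dc -det_mulmx mulmx_block !mulmx0 !mulmx1 !addr0.
  rewrite !mul_mx_scalar !mul_scalar_mx scalerN addNr mulmxN yy det_lblock det_scalar; congr (_ * _).
  by rewrite det_mx11 !mxE !mulr1n mulr1 addrC.
rewrite -dM; congr (_ * _).
have dU : \det (block_mx (1%:M : 'M_n) 0 (- y^T) (1%:M : 'M_1)) = 1 :> {poly R}.
  by rewrite det_lblock !det1 mulr1.
rewrite -[RHS]mulr1 -dU -det_mulmx mulmx_block !mulmx0 !mulmx1 !add0r !mul1mx addrN.
rewrite det_ublock det1 mulr1; congr (\det _); apply/matrixP => i j.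
rewrite !mxE big_ord1 !mxE big_ord1 !mxE rmorphD rmorphM rmorphMn /= opprD addrA.
by rewrite mulrnBl mulrN.
Qed.

(** * Spectral theorem and closed walks *)

Lemma real_sym_spectral n (M : 'M[algC]_n) :
  M^T = M -> (forall i j, M i j \is Num.real) ->
  exists U V : 'M[algC]_n, exists d : 'rV[algC]_n,
    [/\ U *m V = 1%:M /\ V *m U = 1%:M, forall i j, V i j = (U j i)^*,
        M = V *m diag_mx d *m U
      & char_poly M = \prod_i ('X - (d 0 i)%:P)].
Proof.
move=> Msym Mreal.
have Mh : map_mx Num.conj M^T = M.
  by apply/matrixP => i j; rewrite Msym !mxE conj_Creal.
have /orthomx_spectralP : M \is normalmx by apply/normalmxP; rewrite Mh.
set U := spectralmx M; set d := spectral_diag M => eM.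
have Uu : U \in unitmx := spectral_unit M.
exists U, (invmx U), d; split=> //; first by rewrite mulmxV ?mulVmx.
  by move=> i j; rewrite invmx_unitary ?spectral_unitarymx// !mxE.
rewrite {1}eM /char_poly.
have -> : char_poly_mx (invmx U *m diag_mx d *m U) =
    map_mx polyC (invmx U) *m char_poly_mx (diag_mx d) *m map_mx polyC U.
  rewrite /char_poly_mx mulmxBr mulmxBl -!map_mxM; congr (_ - _).
  by rewrite mul_mx_scalar -scalemxAl -map_mxM mulVmx// map_mx1 scalemx1.
rewrite !det_mulmx mulrAC -det_mulmx -map_mxM mulVmx// map_mx1 det1 mul1r.
rewrite -[\det _]/(char_poly _) char_poly_trig; last first.
  by apply/is_trig_mxP => i j ltij; rewrite !mxE -val_eqE /= ltn_eqF.
by apply: eq_bigr => i _; rewrite !mxE eqxx.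
Qed.

Lemma mxtrace_spectral n (U V : 'M[algC]_n) (d : 'rV[algC]_n) j :
  U *m V = 1%:M -> \tr ((V *m diag_mx d *m U) ^+ j) = \sum_i d 0 i ^+ j.
Proof.
move=> UV; have VU := mulmx1C UV.
have -> : (V *m diag_mx d *m U) ^+ j = V *m diag_mx (\row_i d 0 i ^+ j) *m U.
  elim: j => [|j IHj].
    have -> : diag_mx (\row_i d 0 i ^+ 0) = 1%:M.
      by apply/matrixP => a b; rewrite !mxE.
    by rewrite mulmx1 VU.
  rewrite exprS IHj -[_ * _]/(_ *m _) !mulmxA -[_ *m U *m V]mulmxA UV mulmx1.
  rewrite -[V *m _ *m _]mulmxA mulmx_diag; congr (_ *m diag_mx _ *m _).
  by apply/rowP => i; rewrite !mxE exprS.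
rewrite mxtrace_mulC mulmxA UV mul1mx mxtrace_diag.
by apply: eq_bigr => i _; rewrite mxE.
Qed.

(** The characteristic polynomial is odd and so is its degree, hence the multiset of eigenvalues is
    invariant under negation and its odd power sums vanish. *)
Lemma adjmx_trace_odd (G : sgraph) (P : {poly algC}) j :
  char_poly (adjmx G) = 'X * (P \Po 'X^2) -> odd #|G| -> odd j ->
  \tr (adjmx G ^+ j) = 0.
Proof.
move=> cG oG oj; set M := adjmx G.
have Msym : M^T = M by apply/matrixP => a b; rewrite !mxE adj_sym.
have Mreal a b : M a b \is Num.real by rewrite mxE realn.
have [U [V [d [[UV _] _ eM cM]]]] := real_sym_spectral Msym Mreal.
have -> : \tr (M ^+ j) = \sum_i d 0 i ^+ j by rewrite eM mxtrace_spectral.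
have odd_cM : char_poly M \Po (- 'X) = - char_poly M.
  by rewrite cG comp_polyM comp_polyX mulNr -comp_polyA comp_Xn_poly sqrrN.
have cN : \prod_i ('X - (- d 0 i)%:P) = char_poly M.
  apply: oppr_inj; rewrite -odd_cM cM rmorph_prod /=.
  have -> : \prod_i (('X - (d 0 i)%:P) \Po - 'X) =
      \prod_i ((-1 : {poly algC}) * ('X - (- d 0 i)%:P)).
    apply: eq_bigr => i _.
    by rewrite comp_polyB comp_polyX comp_polyC mulN1r polyCN opprK opprD.
  by rewrite big_split prodr_const card_ord -signr_odd oG expr1 /= mulN1r.
have /prod_XsubC_eq pd : \prod_(x <- [seq d 0 i | i : 'I_#|G|]) ('X - x%:P) =
    \prod_(x <- [seq - d 0 i | i : 'I_#|G|]) ('X - x%:P).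
  by rewrite !big_image /= cN.
have sN : \sum_i d 0 i ^+ j = - (\sum_i d 0 i ^+ j).
  have := perm_big _ pd (op := +%R) (x := 0) (P := xpredT) (F := fun x => x ^+ j).
  rewrite !big_image /= => e; rewrite [LHS]e -sumrN; apply: eq_bigr => i _.
  by rewrite exprNn -signr_odd oj expr1 mulN1r.
by apply/eqP; rewrite -eqNr -sN.
Qed.

Lemma adjmx_pow_ge0 (G : sgraph) j a b : 0 <= (adjmx G ^+ j) a b.
Proof.
elim: j a b => [|j IHj] a b; first by rewrite expr0 mxE ler0n.
by rewrite exprS mxE sumr_ge0// => c _; rewrite mulr_ge0// mxE ler0n.
Qed.

Lemma path_pow_gt0 (G : sgraph) x p :
  path (@adj G) x p ->
  0 < (adjmx G ^+ size p) (enum_rank x) (enum_rank (last x p)).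
Proof.
elim: p x => [|y p IHp] x /=; first by rewrite expr0 mxE eqxx ltr01.
case/andP=> xy /IHp pos; rewrite exprS mxE (bigD1 (enum_rank y))//=.
rewrite ltr_pwDl//; first by rewrite mxE !enum_rankK xy mul1r.
by rewrite sumr_ge0// => c _; rewrite mulr_ge0 ?adjmx_pow_ge0// mxE ler0n.
Qed.

(** An odd closed walk would give a positive diagonal entry in an odd power of the adjacency matrix,
    whose entries are nonnegative and whose trace is 0. *)
Lemma closed_path_even (G : sgraph) (P : {poly algC}) (x : G) p :
  char_poly (adjmx G) = 'X * (P \Po 'X^2) -> odd #|G| ->
  path (@adj G) x p -> last x p = x -> ~~ odd (size p).
Proof.
move=> cG oG xp px; apply/negP => /(adjmx_trace_odd cG oG) tr0.
have := path_pow_gt0 xp; rewrite px.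
have /psumr_eq0P -> := tr0; rewrite ?ltxx//.
by move=> i _; apply: adjmx_pow_ge0.
Qed.

Local Close Scope ring_scope.

(** * From spectra to incidence matrices *)

Lemma giso_refl G : giso G G.
Proof. by exists id => //; exists id. Qed.

Lemma giso_sym G H : giso G H -> giso H G.
Proof.
case=> f [g fK gK] fadj; exists g; first by exists f.
by move=> x y; rewrite -fadj !gK.
Qed.

Lemma giso_trans G H K : giso G H -> giso H K -> giso G K.
Proof.
case=> f fbij fadj [g gbij gadj]; exists (g \o f); first exact: bij_comp.
by move=> x y; rewrite /= gadj fadj.
Qed.

Lemma giso_inj (G H : sgraph) (f : G -> H) :
  injective f -> #|H| <= #|G| -> (forall x y, adj (f x) (f y) = adj x y) ->
  giso G H.
Proof. by move=> finj cGH fadj; exists f => //; apply: inj_card_bij. Qed.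

Lemma giso_bip (A B A' B' : finType) (r : A -> B -> bool) (r' : A' -> B' -> bool)
    (f : A -> A') (h : B -> B') :
  bijective f -> bijective h -> (forall a b, r' (f a) (h b) = r a b) ->
  giso (bip_graph r) (bip_graph r').
Proof.
move=> [f' fK f'K] [h' hK h'K] rr'.
pose F (u : A + B) := match u with inl a => inl (f a) | inr b => inr (h b) end.
exists F.
  exists (fun u => match u with inl a => inl (f' a) | inr b => inr (h' b) end).
    by case=> [a|b] /=; rewrite ?fK ?hK.
  by case=> [a|b] /=; rewrite ?f'K ?h'K.
by case=> [a|b] [a'|b'] /=.
Qed.

Lemma giso_bip_swap (A B : finType) (r : A -> B -> bool) :
  giso (bip_graph r) (bip_graph (fun b a => r a b)).
Proof.
pose F (X Y : Type) (u : X + Y) : Y + X :=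
  match u with inl a => inr a | inr b => inl b end.
exists (@F A B); first by exists (@F B A); case.
by case=> [a|b] [a'|b'].
Qed.

(** * Graphs without odd closed walks are bipartite *)

Section Bipartition.

Variable G : sgraph.
Hypothesis closed_even :
  forall (x : G) p, path (@adj G) x p -> last x p = x -> ~~ odd (size p).

(* Adjacency in the bipartite double cover, where an odd closed walk at x becomes
   a walk from (x, false) to (x, true). *)
Let lifted (u v : G * bool) := adj u.1 v.1 && (v.2 == ~~ u.2).

Let lifted_sym : symmetric lifted.
Proof.
by move=> [x b] [y b']; rewrite /lifted /= adj_sym; case: b b' => [] [].
Qed.

Let lifted_path u p : path lifted u p ->
  path (@adj G) u.1 (map fst p) /\ (last u p).2 = u.2 (+) odd (size p).
Proof.
elim: p u => [|v p IHp] u /=; first by rewrite addbF.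
case/andP=> /andP[-> /eqP ev] /IHp[-> ->]; split=> //.
by rewrite ev; case: u.2; case: (odd _).
Qed.

(** Every step flips the second coordinate, so a path between the two lifts of x projects to a
    closed walk of odd length. *)
Let unlifted x : ~~ connect lifted (x, false) (x, true).
Proof.
apply/negP => /connectP[p /lifted_path[xp]] /= par lp.
have lx : last x (map fst p) = x.
  by have := last_map fst p (x, false); rewrite /= -lp.
have := closed_even xp lx; rewrite size_map.
by move: par; rewrite -lp /= => <-.
Qed.

Let lift_connect x b y :
  connect (@adj G) x y -> exists b', connect lifted (x, b) (y, b').
Proof.
case/connectP=> p; elim: p x b => [|z p IHp] x b /=.
  by move=> _ ->; exists b; apply: connect0.
case/andP=> xz zp /(IHp _ (~~ b) zp)[b' zy]; exists b'.
by apply: connect_trans zy; apply: connect1; rewrite /lifted /= xz eqxx.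
Qed.

Lemma bipartition : exists c : pred G, forall x y, adj x y -> c x != c y.
Proof.
have csym := sym_connect_sym (@adj_sym G).
pose rt x := fingraph.root (@adj G) x.
(* The root of the component is a common base point for both ends of an edge. At least one lift of
   each vertex is reachable from it, and by [unlifted] not both. *)
exists (fun x => connect lifted (rt x, false) (x, true)) => x y xy.
have -> : rt y = rt x by symmetry; apply/(fingraph.rootP csym); apply: connect1.
set z := rt x.
have zx b : connect lifted (z, false) (x, b) -> connect lifted (z, false) (y, ~~ b).
  move=> zb; apply: connect_trans zb _; apply: connect1.
  by rewrite /lifted /= xy eqxx.
case zxT: (connect _ _ (x, true)).
  case zyT: (connect _ _ (y, true)) => //.
  have := unlifted y; rewrite (connect_trans _ zyT) //.
  by rewrite (sym_connect_sym lifted_sym) (zx true).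
have [b zb] : exists b, connect lifted (z, false) (x, b).
  by apply: lift_connect; rewrite csym; apply: connect_root.
by case: b zb => [|/zx ->//]; rewrite zxT.
Qed.

End Bipartition.

Lemma giso_bipartition (G : sgraph) (c : pred G) :
  (forall x y, adj x y -> c x != c y) ->
  giso G (bip_graph (fun (x : {x : G | c x}) (y : {y : G | ~~ c y}) =>
                       adj (val x) (val y))).
Proof.
move=> cadj; apply: giso_sym.
pose f (u : {x : G | c x} + {y : G | ~~ c y}) : G :=
  match u with inl x => val x | inr y => val y end.
apply: (@giso_inj (bip_graph _) G f).
- case=> [[x cx]|[x cx]] [[y cy]|[y cy]] /= exy; move: cx cy.
  + by rewrite -{}exy => cx cy; congr inl; apply: val_inj.
  + by rewrite -{}exy => cx cx'; case: (negP cx').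
  + by rewrite -{}exy => cx cx'; case: (negP cx).
  + by rewrite -{}exy => cx cy; congr inr; apply: val_inj.
- by rewrite card_sum !card_sig -(cardC c).
case=> [[x cx]|[x cx]] [[y cy]|[y cy]] //=.
- by apply/negbTE/negP => /cadj; rewrite cx cy.
- exact: adj_sym.
- by apply/negbTE/negP => /cadj; rewrite (negbTE cx) (negbTE cy).
Qed.

Definition rowset (A B : finType) (r : A -> B -> bool) a : {set B} :=
  [set b | r a b].

(* With N the 0/1 matrix of r, these say N N^T = I + x x^T where x_a^2 = |R_a| - 1. *)
Definition good k (A B : finType) (r : A -> B -> bool) : Prop :=
  [/\ #|A| = k /\ #|B| = k.+1,
      forall a, 0 < #|rowset r a|,
      forall a a', a != a' ->
        #|rowset r a :&: rowset r a'| ^ 2 = #|rowset r a|.-1 * #|rowset r a'|.-1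
    & \sum_a #|rowset r a|.-1 = k].

Local Open Scope ring_scope.

(* The characteristic polynomial of N N^T. *)
Definition gram_poly k : {poly algC} := ('X - 1) ^+ k.-1 * ('X - 1 - k%:R%:P).

Lemma incmx_gramE (A B : finType) (r : A -> B -> bool) i j :
  (incmx r *m (incmx r)^T) i j =
    #|rowset r (enum_val i) :&: rowset r (enum_val j)|%:R.
Proof.
rewrite mxE -sum1_card natr_sum [RHS](reindex (@enum_val B predT)) /=; last first.
  exact: onW_bij (enum_val_bij _).
rewrite [RHS]big_mkcond /=; apply: eq_bigr => l _.
by rewrite !mxE !inE; case: (r _ _); case: (r _ _); rewrite ?mulr0 ?mulr1.
Qed.

Lemma good_char_poly k (A B : finType) (r : A -> B -> bool) : (0 < k)%N ->
  good k r -> char_poly (adjmx (bip_graph r)) = 'X * (gram_poly k \Po 'X^2).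
Proof.
move=> k_gt0 [[cA cB] rpos rr rsum].
(* Intersection sizes are nonnegative, so the squared condition in [good] determines them as
   products of these square roots. *)
pose x : 'cV[algC]_#|A| := \col_i sqrtC (#|rowset r (enum_val i)|.-1)%:R.
have gramE : incmx r *m (incmx r)^T = 1%:M + x *m x^T.
  apply/matrixP => i j; rewrite incmx_gramE !mxE big_ord1 !mxE.
  have [<-|nij] := eqVneq i j.
    by rewrite setIid -expr2 sqrtCK -natrD add1n prednK.
  rewrite add0r -sqrtCM ?nnegrE ?ler0n// -natrM -rr; last first.
    by apply: contra_neq nij => /enum_val_inj.
  by rewrite natrX sqrCK ?ler0n.
have xx : (x^T *m x) 0 0 = k%:R.
  rewrite mxE -[in RHS]rsum natr_sum [RHS](reindex (@enum_val A predT)) /=; last first.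
    exact: onW_bij (enum_val_bij _).
  by apply: eq_bigr => i _; rewrite !mxE -expr2 sqrtCK.
have X1_neq0 : 'X - 1 != 0 :> {poly algC} by rewrite -[1]polyC1 polyXsubC_eq0.
have gP : char_poly (incmx r *m (incmx r)^T) = gram_poly k.
  apply: (mulIf X1_neq0); rewrite gramE char_poly_1_rank1 xx /gram_poly mulrAC.
  by rewrite -exprSr prednK ?cA.
have Xn_neq0 n : 'X^n != 0 :> {poly algC} by rewrite monic_neq0 ?monicXn.
have := char_poly_bip r; rewrite gP cA cB.
have -> : 'X^(k.+1) = 'X * 'X^k :> {poly algC} by rewrite exprS.
by rewrite mulrA [_ * 'X]mulrC; apply: mulIf.
Qed.

(** All eigenvalues of M = N N^T are 1 except one, k+1, at the index [i0]. Hence M = I + k u^* u,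
    where u is the row [i0] of the unitary U. The diagonal of M gives the row sizes, its other
    entries the intersections, and the norm 1 of u the sum. *)
Lemma gram_good k (A B : finType) (r : A -> B -> bool) : (0 < k)%N ->
  #|A| = k -> #|B| = k.+1 ->
  char_poly (incmx r *m (incmx r)^T) = gram_poly k -> good k r.
Proof.
move=> k_gt0 cA cB; set M := incmx r *m _ => cM.
have ME := incmx_gramE r; rewrite -/M in ME.
have Msym : M^T = M by apply/matrixP => i j; rewrite mxE !ME setIC.
have Mreal i j : M i j \is Num.real by rewrite ME realn.
have [U [V [d [[UV VU] VE eM]]]] := real_sym_spectral Msym Mreal.
rewrite cM => cd.
have pd : perm_eq [seq d 0 i | i : 'I_#|A|] (rcons (nseq k.-1 1) (k.+1)%:R).
  apply: prod_XsubC_eq; rewrite big_image /= -cd -cats1 big_cat big_seq1 /=.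
  rewrite big_nseq /gram_poly; congr (_ * _).
    by elim: k.-1 => [|n IHn]; rewrite //= exprS -IHn polyC1.
  by rewrite -natr1 polyCD polyC1 opprD addrA addrAC.
have : #|[pred i | d 0 i != 1]| == 1%N.
  rewrite cardE /enum_mem size_filter; have := seq.permP pd (predC1 1).
  rewrite -cats1 count_cat count_map [enum _]enumT /= => ->.
  have -> : count (predC1 1) (nseq k.-1 (1 : algC)) = 0%N.
    by rewrite count_nseq /= eqxx.
  by rewrite -natr1 -[X in _ != X]add0r (inj_eq (addIr _)) pnatr_eq0 -lt0n k_gt0.
case/card1P=> i0 di0.
have d1 i : i != i0 -> d 0 i = 1.
  by move=> ni; have := di0 i; rewrite !inE (negbTE ni) => /negbFE/eqP.
have dk : d 0 i0 = k.+1%:R.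
  have: d 0 i0 \in rcons (nseq k.-1 1) (k.+1)%:R.
    by rewrite -(perm_mem pd); apply: image_f.
  rewrite mem_rcons inE => /orP[/eqP//|/nseqP[d01 _]].
  by have := di0 i0; rewrite !inE d01 !eqxx.
have entry i j : M i j = (i == j)%:R + k%:R * (U i0 i)^* * U i0 j.
  rewrite eM mxE (bigD1 i0)//= mul_mx_diag mxE dk VE.
  have := congr1 (fun N : 'M_#|A| => N i j) VU; rewrite !mxE (bigD1 i0)//= VE => <-.
  rewrite [X in X + _ = _](_ : _ = (U i0 i)^* * U i0 j + k%:R * (U i0 i)^* * U i0 j).
    rewrite addrAC; congr (_ + _); congr (_ + _).
    by apply: eq_bigr => l nl; rewrite !mxE d1 ?mulr1.
  by rewrite -natr1 mulrDr mulr1 mulrDl addrC [_ * k%:R]mulrC.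
have diag a : #|rowset r a|%:R = 1 + k%:R * `|U i0 (enum_rank a)| ^+ 2.
  have := ME (enum_rank a) (enum_rank a).
  by rewrite setIid enum_rankK entry eqxx normCK -mulrA [_^* * _]mulrC.
have rpos a : (0 < #|rowset r a|)%N.
  by rewrite -(ler_nat algC) diag lerDl mulr_ge0 ?ler0n ?exprn_ge0.
have pdiag a : #|rowset r a|.-1%:R = k%:R * `|U i0 (enum_rank a)| ^+ 2.
  by apply: (addrI 1); rewrite -diag nat1r prednK.
split=> //.
- move=> a a' naa'; apply/eqP; rewrite -(eqr_nat algC) natrM !pdiag natrX.
  have := ME (enum_rank a) (enum_rank a'); rewrite entry !enum_rankK.
  rewrite (inj_eq enum_rank_inj) (negbTE naa') add0r => e.
  (* The intersection size is real, so its square is its product with its conjugate; this turns the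
     unknown phases of u into absolute values. *)
  rewrite expr2 -[X in X * _]conjC_nat -e !rmorphM /= conjCK conjC_nat !normCK.
  by apply/eqP; ring.
apply/eqP; rewrite -(eqr_nat algC) natr_sum (reindex (@enum_val A predT)) /=; last first.
  exact: onW_bij (enum_val_bij _).
have := congr1 (fun N : 'M_#|A| => N i0 i0) UV; rewrite !mxE eqxx mulr1n => e1.
apply/eqP; rewrite -[RHS]mulr1 -[X in _ * X]e1 mulr_sumr; apply: eq_bigr => i _.
by rewrite pdiag enum_valK normCK VE.
Qed.

(** The smaller side of the bipartition, of size at most k, supplies the rows. With e the difference
    of the two sizes, X^e divides the characteristic polynomial; since 0 is a simple root and the
    order is odd, e = 1. *)
Lemma cospectral_good k (G : sgraph) : (0 < k)%N ->
  char_poly (adjmx G) = 'X * (gram_poly k \Po 'X^2) -> #|G| = (2 * k + 1)%N ->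
  exists A B : finType, exists2 r : A -> B -> bool, good k r & giso G (bip_graph r).
Proof.
move=> k_gt0 cG oG.
have [c /giso_bipartition Gr] : exists c : pred G, forall x y, adj x y -> c x != c y.
  apply: bipartition => x p; apply: closed_path_even cG _.
  by rewrite oG addn1 /= oddM.
suff Gbip (A B : finType) (r : A -> B -> bool) :
    giso G (bip_graph r) -> (#|A| <= k)%N -> good k r.
  have [] := leqP #|{: {x | c x}}| k => cA; first by do 3!eexists; [exact: Gbip Gr cA|].
  have Gr' := giso_trans Gr (giso_bip_swap _).
  have cB : (#|{: {x | ~~ c x}}| <= k)%N.
    have : #|G| = #|{: {x | c x}}| + #|{: {x | ~~ c x}}| :> nat.
      by case: Gr => f /bij_eq_card-> _; rewrite card_sum.
    by rewrite oG; move: cA; lia.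
  by do 3!eexists; [exact: Gbip Gr' cB|].
move=> {c Gr} Gr leAk.
have cAB : (#|A| + #|B| = 2 * k + 1)%N.
  by rewrite -oG; case: Gr => f /bij_eq_card-> _; rewrite card_sum.
pose e := (#|B| - #|A|)%N.
have eB : (#|B| = e + #|A|)%N by rewrite /e; lia.
have Xn_neq0 n : 'X^n != 0 :> {poly algC} by rewrite monic_neq0 ?monicXn.
have := char_poly_bip r; rewrite -(giso_char_poly Gr) cG.
set P := char_poly _; rewrite eB exprD mulrA => /(mulIf (Xn_neq0 _)) eP.
have e_gt0 : (0 < e)%N by rewrite /e; lia.
have : 'X * (gram_poly k \Po 'X^2) = 'X * ((P \Po 'X^2) * 'X^(e.-1)).
  by rewrite eP mulrCA -exprS prednK.
move=> /(mulfI (negbT (polyX_eq0 _))) {}eP.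
have e1 : e = 1%N.
  apply/eqP; rewrite eqn_leq e_gt0 andbT leqNgt; apply/negP => e_gt1.
  (* At 0 the polynomial [gram_poly k] takes the value k+1 up to sign, so it leaves no room for a
     further factor X. *)
  have /eqP := congr1 (fun p : {poly algC} => p.[0]) eP.
  rewrite hornerM hornerXn expr0n -subn1 subn_eq0 leqNgt e_gt1 mulr0 horner_comp.
  rewrite /gram_poly !hornerE expr0n /= mulf_eq0 expf_eq0 sub0r oppr_eq0 oner_eq0 andbF.
  by rewrite -opprD oppr_eq0 -(natrD _ 1) pnatr_eq0.
move: eP; rewrite e1 expr0 mulr1 => eP.
apply: gram_good => //; [lia | lia |].
apply/eqP; rewrite -subr_eq0 -(@comp_poly_eq0 _ _ 'X^2) ?size_polyXn//.
by rewrite comp_polyB eP subrr.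
Qed.

Local Close Scope ring_scope.

(** * Candidate incidence structures *)

(* The k+1 columns are indexed by [option A], A being the set of rows: one column
   is attached to each row, and [None] is the remaining one. A row is a singleton
   (a component K_2) if [s a = None], big if [s a = Some true] and small if
   [s a = Some false]. Up to components K_1 and K_2, KR gives R and the star, KQ
   gives Q, KH gives H, G_3 and G_4, KL gives L and G_2, KG gives G_1. *)
Inductive kind := KR | KQ | KH | KL | KG.

(** Big rows contain every column attached to a small row; the big-big and small-small blocks are I
    or J - I, except that the big-big block of KG is zero. The isolated vertex of KL is the column
    [None], that of KG the column attached to its only big row. *)
Definition kind_rel (f : kind) (A : eqType) (s : A -> option bool)
    (a : A) (b : option A) : bool :=
  match b with
  | None => match f with
            | KR | KH | KG => s a != None
            | KQ => s a == Some true
            | KL => false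
            end
  | Some c =>
    match s c with
    | Some true => match f with
                   | KR | KQ => a == c
                   | KH | KL => (s a == Some true) && (a != c)
                   | KG => false
                   end
    | Some false => (s a == Some true) || match f with
                    | KR | KH | KG => a == c
                    | KQ | KL => (s a == Some false) && (a != c)
                    end
    | None => a == c
    end
  end.

Definition nsort (A : finType) (s : A -> option bool) x := #|[pred a | s a == x]|.

(** * Counting rows by sort *)

Section SortCounting.

Variables (A : finType) (s : A -> option bool).
Notation n := (nsort s).

Lemma sum_sort (F : option bool -> nat) :
  \sum_a F (s a) = n (Some true) * F (Some true) + n (Some false) * F (Some false)
    + n None * F None.
Proof.
have -> : \sum_a F (s a) = \sum_(x : option bool) \sum_(a | s a == x) F x.
  rewrite (partition_big s predT) //=; apply: eq_bigr => x _.
  by apply: eq_big => a //= /eqP->.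
rewrite (bigD1 None)//= (bigD1 (Some true))//= (bigD1 (Some false))//=.
rewrite [X in _ + (_ + (_ + X))]big1; last by case=> [[]|].
by rewrite !sum_nat_const addn0 addnC.
Qed.

Lemma card_sort (F : option bool -> bool) :
  #|[set a | F (s a)]| =
    n (Some true) * F (Some true) + n (Some false) * F (Some false) + n None * F None.
Proof.
rewrite -(sum_sort (fun x => F x : nat)) -sum1_card big_mkcond /=.
by apply: eq_bigr => a _; rewrite inE; case: (F _).
Qed.

(** The second argument of [F] tells whether c is the marked element a. Forgetting the mark changes
    only the contribution of a; the correction terms stand on opposite sides to avoid truncated
    subtraction. [card_sort2] does the same for two marks. *)
Lemma card_sort1 (F : option bool -> bool -> bool) a :
  #|[set c | F (s c) (c == a)]| + F (s a) false =
    F (s a) true + #|[set c | F (s c) false]|.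
Proof.
rewrite -!sum1_card big_mkcond [X in _ = _ + X]big_mkcond /=.
rewrite (bigD1 a)//= [X in _ = _ + X](bigD1 a)//= !inE eqxx.
rewrite (eq_bigr (fun c => if c \in [set c | F (s c) false] then 1 else 0)).
  by case: (F (s a) true); case: (F (s a) false); rewrite /=; lia.
by move=> c nc; rewrite !inE (negbTE nc).
Qed.

Lemma card_sort2 (F : option bool -> bool -> bool -> bool) a a' : a != a' ->
  #|[set c | F (s c) (c == a) (c == a')]| + F (s a) false false + F (s a') false false
  = F (s a) true false + F (s a') false true + #|[set c | F (s c) false false]|.
Proof.
move=> naa'; rewrite -!sum1_card big_mkcond [X in _ = _ + X]big_mkcond /=.
rewrite (bigD1 a)//= (bigD1 a')//=; last by rewrite eq_sym.
rewrite [X in _ = _ + X](bigD1 a)//= [X in _ = _ + (_ + X)](bigD1 a')//=; last first.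
  by rewrite eq_sym.
rewrite !inE !eqxx (negbTE naa') eq_sym (negbTE naa').
rewrite (eq_bigr (fun c => if c \in [set c | F (s c) false false] then 1 else 0)).
  by do 4!case: (F _ _ _); rewrite /=; lia.
by move=> c /andP[/negbTE nc /negbTE nc']; rewrite !inE nc nc'.
Qed.

End SortCounting.

Lemma card_set_option (A : finType) (P : pred (option A)) :
  #|[set b | P b]| = P None + #|[set a | P (Some a)]|.
Proof.
rewrite -!sum1_card big_mkcond [X in _ = _ + X]big_mkcond /= (bigD1 None)//= inE.
have ifE (b : bool) : (if b then 1 else 0) = b by case: b.
rewrite ifE; congr (_ + _).
rewrite (reindex_omap Some id); last by case.
by apply: eq_big => a; rewrite ?eqxx ?inE.
Qed.

(** Here and in [colcard] and [meetcard] the truncated subtractions are harmless, because a value is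
    read only for sorts that occur, and for two distinct rows of one sort only when that sort occurs
    twice. *)
Definition rowcard f p q (x : option bool) : nat :=
  match x with
  | None => 1
  | Some true => match f with
                 | KR | KQ => q.+2 | KH => p + q | KL => p + q - 1 | KG => q.+1
                 end
  | Some false => match f with KR | KH | KG => 2 | KQ | KL => q - 1 end
  end.

Definition colcard f p q (x : option (option bool)) : nat :=
  match x with
  | None => match f with KR | KH | KG => p + q | KQ => p | KL => 0 end
  | Some None => 1
  | Some (Some true) => match f with KR | KQ => 1 | KH | KL => p - 1 | KG => 0 end
  | Some (Some false) => match f with KR | KH | KG => p.+1 | KQ | KL => p + q - 1 end
  end.

Definition meetcard f p q (x y : option bool) : nat :=
  match x, y with
  | Some true, Some true => match f with
       | KR | KQ | KG => q.+1 | KH => p + q - 1 | KL => p + q - 2 end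
  | Some true, Some false | Some false, Some true => 
      match f with KR | KH | KG => 2 | KQ | KL => q - 1 end
  | Some false, Some false => 
      match f with KR | KH | KG => 1 | KQ | KL => q - 2 end
  | _, _ => 0
  end.

Section KindCards.

Variables (f : kind) (A : finType) (s : A -> option bool).
Let p := nsort s (Some true).
Let q := nsort s (Some false).

Lemma nsort_gt0 a : 0 < nsort s (s a).
Proof. by apply/card_gt0P; exists a; rewrite inE. Qed.

Lemma nsort_gt1 a a' : a != a' -> s a' = s a -> 1 < nsort s (s a).
Proof. by move=> naa' e; apply/card_gt1P; exists a, a'; rewrite !inE e ?eqxx. Qed.

Lemma card_kind_row a : #|rowset (kind_rel f s) a| = rowcard f p q (s a).
Proof.
pose N := #|[set c | kind_rel f s a (Some c)]|.
have -> : #|rowset (kind_rel f s) a| = kind_rel f s a None + N.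
  by rewrite card_set_option.
pose F x b := match x with
    | Some true => match f with
                   | KR | KQ => b
                   | KH | KL => (s a == Some true) && ~~ b
                   | KG => false
                   end
    | Some false => (s a == Some true) || match f with
                    | KR | KH | KG => b
                    | KQ | KL => (s a == Some false) && ~~ b
                    end
    | None => b
    end.
have := card_sort1 s F a; rewrite (card_sort s (fun x => F x false)) -/p -/q.
have -> : [set c | F (s c) (c == a)] = [set c | kind_rel f s a (Some c)].
  by apply/setP => c; rewrite !inE /F /= [c == a]eq_sym; case: (s c) => [[]|].
rewrite -/N /F /rowcard /kind_rel; have := nsort_gt0 a.
by case: (s a) => [[]|]; rewrite /= -?/p -?/q; case: f => /=; lia.
Qed.

Lemma card_kind_meet a a' : a != a' ->
  #|rowset (kind_rel f s) a :&: rowset (kind_rel f s) a'| = meetcard f p q (s a) (s a').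
Proof.
move=> naa'; pose N := #|[set c | kind_rel f s a (Some c) && kind_rel f s a' (Some c)]|.
have -> : #|rowset (kind_rel f s) a :&: rowset (kind_rel f s) a'| =
    (kind_rel f s a None && kind_rel f s a' None) + N.
  rewrite -(card_set_option (fun b => kind_rel f s a b && kind_rel f s a' b)).
  by apply: eq_card => b; rewrite !inE.
pose F0 y x b := match x with
    | Some true => match f with
                   | KR | KQ => b
                   | KH | KL => (y == Some true) && ~~ b
                   | KG => false
                   end
    | Some false => (y == Some true) || match f with
                    | KR | KH | KG => b
                    | KQ | KL => (y == Some false) && ~~ b
                    end
    | None => b
    end.
pose F x b b' := F0 (s a) x b && F0 (s a') x b'.
have := card_sort2 s F naa'; rewrite (card_sort s (fun x => F x false false)) -/p -/q.
have -> : [set c | F (s c) (c == a) (c == a')] =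
    [set c | kind_rel f s a (Some c) && kind_rel f s a' (Some c)].
  apply/setP => c; rewrite !inE /F /F0 /= [c == a]eq_sym [c == a']eq_sym.
  by case: (s c) => [[]|].
rewrite -/N /F /F0 /meetcard /kind_rel; have := nsort_gt0 a; have := nsort_gt0 a'.
have := @nsort_gt1 a a' naa'.
case: (s a) => [[]|]; case: (s a') => [[]|]; rewrite /= -?/p -?/q;
  case: f => /=; do ?[move/(_ erefl)]; lia.
Qed.

Lemma card_kind_col b :
  #|[set a | kind_rel f s a b]| = colcard f p q (omap s b).
Proof.
case: b => [c|]; last first.
  pose G (x : option bool) := match f with
      | KR | KH | KG => x != None | KQ => x == Some true | KL => false end.
  have -> : #|[set a | kind_rel f s a None]| = _ := card_sort s G.
  by rewrite -/p -/q /G; case: f => /=; lia.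
pose N := #|[set a | kind_rel f s a (Some c)]|.
pose F x b := match s c with
    | Some true => match f with
                   | KR | KQ => b
                   | KH | KL => (x == Some true) && ~~ b
                   | KG => false
                   end
    | Some false => (x == Some true) || match f with
                    | KR | KH | KG => b
                    | KQ | KL => (x == Some false) && ~~ b
                    end
    | None => b
    end.
have := card_sort1 s F c; rewrite (card_sort s (fun x => F x false)) -/p -/q.
rewrite -/N /F /= -/N; have := nsort_gt0 c.
by case: (s c) => [[]|]; rewrite /= -?/p -?/q; case: f => /=; lia.
Qed.

End KindCards.

Definition sortk p q k (i : 'I_k) : option bool :=
  if i < p then Some true else if i < p + q then Some false else None.

Definition kind_graph f k p q : sgraph := bip_graph (kind_rel f (@sortk p q k)).

(** With a single row size, k is the number of rows times the size minus 1: k rows of size 2 for the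
    star, p rows of size p for KH, p rows of size p - 1 for KL. With both sizes k = 4 p + q, and the
    numbers are forced by big rows having 5 elements and small ones 2: q + 2 = 5 for KR and KQ, p +
    q = 5 for KH, p + q - 1 = 5 and q - 1 = 2 for KL, q + 1 = 5 for KG. *)
Definition kind_params f k p q : Prop :=
  p + q <= k /\
  match f with
  | KR => p = 0 /\ q = k \/ q = 3 /\ k = 4 * p + 3
  | KQ => q = 3 /\ k = 4 * p + 3
  | KH => (q = 0 /\ k = p * (p - 1)) \/ (p = 3 /\ q = 2 /\ k = 14)
          \/ (p = 4 /\ q = 1 /\ k = 17)
  | KL => (q = 0 /\ k = p * (p - 2)) \/ (p = 3 /\ q = 3 /\ k = 15)
  | KG => p = 1 /\ q = 4 /\ k = 8
  end.

Lemma card_ord_lt k m : m <= k -> #|[pred i : 'I_k | i < m]| = m.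
Proof.
by move=> lemk; rewrite -sum1_card -(big_ord_widen _ (fun=> 1)) ?sum1_card ?card_ord.
Qed.

Lemma nsort_sortk p q k : p + q <= k ->
  [/\ nsort (@sortk p q k) (Some true) = p, nsort (@sortk p q k) (Some false) = q
    & nsort (@sortk p q k) None = k - (p + q)].
Proof.
move=> lek; have np : nsort (@sortk p q k) (Some true) = p.
  rewrite -[RHS](@card_ord_lt k); last by lia.
  by apply: eq_card => i; rewrite !inE /sortk; case: ifP => //; case: ifP.
have nq : nsort (@sortk p q k) (Some false) = q.
  apply: (@addnI p); rewrite -[in RHS](@card_ord_lt k (p + q))//.
  rewrite -(cardID [pred i : 'I_k | i < p] [pred i : 'I_k | i < p + q]).
  rewrite -{1}(@card_ord_lt k p); last by lia.
  congr (_ + _); apply: eq_card => i; rewrite !inE /sortk; first by lia.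
  by case: ifP => //=; case: ifP.
split=> //; have := sum_sort (@sortk p q k) (fun=> 1).
by rewrite sum1_card card_ord np nq; lia.
Qed.

Lemma kind_good f k p q : 0 < k -> kind_params f k p q ->
  good k (kind_rel f (@sortk p q k)).
Proof.
move=> k_gt0 [lek par]; have [np nq nN] := nsort_sortk lek.
have pos := @nsort_gt0 _ (@sortk p q k).
split.
- by rewrite card_option card_ord.
- move=> a; rewrite card_kind_row np nq; have := pos a.
  case: (sortk _ _ _) => [[]|]; rewrite ?np ?nq /=;
    case: f par => /= par; nia.
- move=> a a' naa'; rewrite card_kind_meet// !card_kind_row np nq.
  have := pos a; have := pos a'; have := nsort_gt1 (s := @sortk p q k) naa'.
  case: (sortk _ _ a) => [[]|]; case: (sortk _ _ a') => [[]|];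
    rewrite ?np ?nq /=; do ?[move/(_ erefl)]; rewrite ?np ?nq /=;
    case: f par => /= par; rewrite -?mulnn; nia.
under eq_bigr => a _ do rewrite card_kind_row np nq.
rewrite (sum_sort _ (fun x => (rowcard f p q x).-1)) np nq nN.
case: f par => /= par; nia.
Qed.

(** Listing the rows as big, small, singleton makes the position of a row its label in the normal
    form, and the attached columns follow their rows. Since there are as many columns as elements of
    [option A], injectivity of [h] suffices. *)
Lemma giso_kind_graph f k p q (A B : finType) (r : A -> B -> bool)
    (s : A -> option bool) (h : option A -> B) :
  #|A| = k -> #|B| = k.+1 -> nsort s (Some true) = p -> nsort s (Some false) = q ->
  injective h -> (forall a b, r a (h b) = kind_rel f s a b) ->
  giso (bip_graph r) (kind_graph f k p q).
Proof.
move=> cA cB np nq hinj rh.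
pose part x := [seq a <- enum A | s a == x].
pose L := part (Some true) ++ part (Some false) ++ part None.
have szp x : size (part x) = nsort s x.
  by rewrite /nsort cardE /part enumT; congr size; apply: eq_filter.
have inp x a : (a \in part x) = (s a == x) by rewrite mem_filter mem_enum andbT.
have szL : size L = k.
  rewrite !size_cat !szp -cA; have := sum_sort s (fun=> 1).
  by rewrite sum1_card !muln1 addnA.
have inL a : a \in L by rewrite !mem_cat !inp; case: (s a) => [[]|].
have Lk a : index a L < k by rewrite -szL index_mem.
pose phi a := Ordinal (Lk a).
have phi_inj : injective phi.
  by move=> a a' [/(congr1 (nth a L))]; rewrite !nth_index.
have phi_bij : bijective phi by apply: inj_card_bij; rewrite // card_ord cA.
have sphi a : @sortk p q k (phi a) = s a.
  rewrite /sortk /= /L !index_cat !inp !szp np nq.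
  have ix x : s a = x -> index a (part x) < nsort s x.
    by move=> e; rewrite -szp index_mem inp e.
  case: (s a) ix => [[]|] ix /=.
  - by have := ix _ erefl; rewrite np => ->.
  - have := ix _ erefl; rewrite nq => lt_q.
    by case: ifP; [lia | case: ifP => //; lia].
  - by do 2!(case: ifP; first by lia).
have [h' hK h'K] : bijective h.
  by apply: inj_card_bij; rewrite // card_option cA cB.
have [psi phiK psiK] := phi_bij.
apply: (giso_bip (f := phi) (h := omap phi \o h')) => //.
  exists (h \o omap psi) => [b|b] /=.
    by case: (h' b) (h'K b) => [a|] /= <-; rewrite ?phiK.
  by rewrite hK; case: b => //= a; rewrite psiK.
move=> a b; rewrite -{2}(h'K b) rh /=; case: (h' b) => [c|] /=; rewrite !sphi //.
by rewrite (inj_eq phi_inj).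
Qed.

(** * Classification *)

Lemma cardsD1_succ (T : finType) (P : {set T}) y n :
  y \in P -> #|P| = n.+1 -> #|P :\ y| = n.
Proof. by move=> Py; rewrite (cardsD1 y) Py => -[]. Qed.

(** * Families of sets of size c+1 that meet pairwise in c points *)

Section UniformFamily.

Variables (A B : finType) (R : A -> {set B}) (S : {set A}) (c : nat).
Hypothesis card_R : {in S, forall a, #|R a| = c.+1}.
Hypothesis card_RI : {in S &, forall a a', a != a' -> #|R a :&: R a'| = c}.

Definition sunflower (K : {set B}) (w : A -> B) :=
  [/\ #|K| = c, {in S, forall a, w a \notin K}, {in S, forall a, R a = w a |: K}
    & {in S &, injective w}].

Definition cosunflower (X : {set B}) (w : A -> B) :=
  [/\ #|X| = c.+2, {in S, forall a, w a \in X}, {in S, forall a, R a = X :\ w a}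
    & {in S &, injective w}].

Let R_inj : {in S &, injective R}.
Proof.
move=> a a' Sa Sa' eR; apply/eqP/negP => /negP naa'.
by have := card_RI Sa Sa' naa'; rewrite eR setIid card_R//; lia.
Qed.

Let sunflowerI (K : {set B}) : 0 < #|S| -> #|K| = c -> {in S, forall a, K \subset R a} ->
  exists w, sunflower K w.
Proof.
move=> /card_gt0P[a0 Sa0] cK KR.
(* The choice of [w] needs a value for every a; outside S it is an arbitrary point. *)
have D1 a : exists x, a \in S -> R a :\: K = [set x].
  case Sa: (a \in S); last first.
    have /card_gt0P[x _] : 0 < #|R a0| by rewrite card_R.
    by exists x.
  have /cards1P[x ex] : #|R a :\: K| == 1.
    by rewrite cardsD (setIidPr (KR a Sa)) card_R// cK subSnn.
  by exists x.
have {D1}[w D1] := fin_all_exists D1; exists w.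
have Rw : {in S, forall a, R a = w a |: K}.
  by move=> a Sa; rewrite -D1// setUC -[in LHS](setID (R a) K) (setIidPr (KR a Sa)).
split=> //.
  by move=> a /D1 /setP/(_ (w a)); rewrite !inE eqxx => /andP[].
by move=> a a' Sa Sa' ew; apply: R_inj; rewrite // !Rw// ew.
Qed.

Let cosunflowerI (X : {set B}) : 0 < #|S| -> #|X| = c.+2 -> {in S, forall a, R a \subset X} ->
  exists w, cosunflower X w.
Proof.
move=> /card_gt0P[a0 Sa0] cX RX.
have D1 a : exists x, a \in S -> X :\: R a = [set x].
  case Sa: (a \in S); last first.
    have /card_gt0P[x _] : 0 < #|R a0| by rewrite card_R.
    by exists x.
  have /cards1P[x ex] : #|X :\: R a| == 1.
    by rewrite cardsD (setIidPr (RX a Sa)) card_R// cX subSnn.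
  by exists x.
have {D1}[w D1] := fin_all_exists D1; exists w.
have Rw : {in S, forall a, R a = X :\ w a}.
  by move=> a Sa; rewrite -D1// setDDr setDv set0U; apply/esym/setIidPr/RX.
split=> //.
  by move=> a /D1 /setP/(_ (w a)); rewrite !inE eqxx => /andP[].
by move=> a a' Sa Sa' ew; apply: R_inj; rewrite // !Rw// ew.
Qed.

(** If no c-set above V lies in all rows, then two rows meet in a c-set K and a third one misses
    some y in K; these three already determine X, the union of the first two. V is empty for
    families with one row size, and the union of the small rows when the family consists of the big
    ones. *)
Lemma uniform_family (V : {set B}) : 0 < #|S| ->
  #|V| <= c -> {in S, forall a, V \subset R a} ->
  (exists K w, sunflower K w /\ V \subset K) \/
  (exists X w, cosunflower X w /\ 2 < #|S|).
Proof.
move=> S_gt0 cV VR.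
have [/existsP[K /and3P[VK /eqP cK /forall_inP KR]]|noK] := boolP
    [exists K : {set B}, [&& V \subset K, #|K| == c & [forall a in S, K \subset R a]]].
  by left; have [w Kw] := sunflowerI S_gt0 cK KR; exists K, w.
right; have {}noK (K : {set B}) : V \subset K -> #|K| = c ->
    exists2 a, a \in S & ~~ (K \subset R a).
  move=> VK cK; apply/exists_inP; rewrite -negb_forall_in; apply/negP => KR.
  by case/existsP: noK; exists K; rewrite VK cK eqxx.
have [a1 Sa1] := card_gt0P S_gt0.
have [a2 Sa2 n21] : exists2 a2, a2 \in S & a2 != a1.
  (* Removing from R a1 a point outside V leaves a c-set above V; a row that does not contain this
     c-set differs from a1. *)
  have /card_gt0P[x] : 0 < #|R a1 :\: V|.
    by rewrite cardsD (setIidPr (VR a1 Sa1)) card_R//; lia.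
  rewrite inE => /andP[nVx Rx].
  have [||a Sa] := noK (R a1 :\ x).
  - by rewrite subsetD1 VR.
  - by have := cardsD1 x (R a1); rewrite Rx card_R// => -[].
  by move=> nRa; exists a => //; apply: contraNneq nRa => ->; rewrite subsetDl.
have n12 : a1 != a2 by rewrite eq_sym.
pose K := R a1 :&: R a2; pose X := R a1 :|: R a2.
have cK : #|K| = c by apply: card_RI.
have cX : #|X| = c.+2.
  by have := cardsUI (R a1) (R a2); rewrite -/X -/K cK !card_R//; lia.
have [||a3 Sa3 /subsetPn[y Ky n3y]] := noK K; rewrite ?subsetI ?VR//.
have /andP[R1y R2y] : (y \in R a1) && (y \in R a2) by move: Ky; rewrite inE.
have n13 : a1 != a3 by apply: contraNneq n3y => <-.
have n23 : a2 != a3 by apply: contraNneq n3y => <-.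
(* A row through y meets R a3 in c points other than y, which are all of its remaining points. *)
have RI3 a : a \in S -> a != a3 -> y \in R a -> R a :\ y \subset R a3.
  move=> Sa na3 Ray; suff -> : R a :\ y = R a :&: R a3 by apply: subsetIr.
  apply/esym/eqP; rewrite eqEcard; apply/andP; split.
    by rewrite subsetD1 subsetIl inE (negbTE n3y) andbF.
  by rewrite card_RI// (cardsD1_succ Ray (card_R Sa)).
have R3 : R a3 = X :\ y.
  apply/esym/eqP; rewrite eqEcard /X setDUl subUset !RI3//= card_R//.
  by rewrite -setDUl -/X (cardsD1_succ _ cX)// inE R1y.
(* The c points other than z of a row with a point z outside X would lie in all three rows, hence in
   K minus y, which has only c - 1 points. *)
have RX : {in S, forall a, R a \subset X}.
  move=> a Sa; have [->|n1] := eqVneq a a1; first exact: subsetUl.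
  have [->|n2] := eqVneq a a2; first exact: subsetUr.
  have [->|n3] := eqVneq a a3; first by rewrite R3 subsetDl.
  apply/subsetP => z Raz; apply: contraT => nXz.
  have Rz b : b \in S -> a != b -> z \notin R b -> R a :\ z \subset R b.
    move=> Sb nab nbz; suff -> : R a :\ z = R a :&: R b by apply: subsetIr.
    apply/esym/eqP; rewrite eqEcard; apply/andP; split.
      by rewrite subsetD1 subsetIl inE (negbTE nbz) andbF.
    by rewrite card_RI// (cardsD1_succ Raz (card_R Sa)).
  have nR1 : z \notin R a1 by apply: contra nXz; apply/subsetP/subsetUl.
  have nR2 : z \notin R a2 by apply: contra nXz; apply/subsetP/subsetUr.
  have nR3 : z \notin R a3 by apply: contra nXz; rewrite R3; apply/subsetP/subsetDl.
  have : R a :\ z \subset K :\ y.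
    rewrite subsetD1 subsetI !Rz//=; apply: contra n3y; apply/subsetP/Rz => //.
  move/subset_leq_card; rewrite (cardsD1_succ Raz (card_R Sa)).
  by rewrite -cK (cardsD1 y K) Ky ltnn.
have [w Xw] := cosunflowerI S_gt0 cX RX; exists X, w; split=> //.
by apply/card_gt2P; exists a1, a2, a3; split=> //; split=> //; rewrite eq_sym.
Qed.

End UniformFamily.

Definition sort_of (A : finType) (P Q : {set A}) a : option bool :=
  if a \in P then Some true else if a \in Q then Some false else None.

(** From x^2 < x y = c^2 and c <= x + 1 follows c = x + 1, hence x (y - x - 2) = 1. No root of x or
    y is needed. *)
Lemma sqr_eq_mul_between x y c :
  0 < x -> x < y -> c ^ 2 = x * y -> c <= x.+1 -> [/\ x = 1, y = 4 & c = 2].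
Proof.
rewrite -mulnn => x_gt0 ltxy cc lec.
have ec : c = x.+1 by nia.
have : x * (y - x - 2) == 1 by apply/eqP; nia.
by rewrite muln_eq1 => /andP[/eqP x1 _]; split; nia.
Qed.

Section Classification.

Variables (k : nat) (A B : finType) (r : A -> B -> bool).
Hypotheses (k_gt0 : 0 < k) (r_good : good k r).

Notation R := (rowset r).
(** This is the square of the coordinate x_a in N N^T = I + x x^T. *)
Let x a := #|R a|.-1.

Let S := [set a | 0 < x a].
(* The columns outside the components K_2, including a zero column if there is one. *)
Let W := [set b | [forall a in ~: S, ~~ r a b]].

Let cR a : #|R a| = (x a).+1.
Proof. by case: r_good => _ pos _ _; rewrite prednK. Qed.

Let meetE a a' : a != a' -> #|R a :&: R a'| ^ 2 = x a * x a'.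
Proof. by case: r_good => _ _ meet _; apply: meet. Qed.

Let singleton_row a : exists b, a \notin S -> R a = [set b].
Proof.
have /card_gt0P[b0 _] : 0 < #|R a| by rewrite cR.
case Sa: (a \in S); first by exists b0.
have /cards1P[b Rb] : #|R a| == 1.
  by rewrite cR; move: Sa; rewrite inE lt0n => /negbFE/eqP->.
by exists b.
Qed.

(** For a singleton row the intersection condition has right-hand side 0, so its column is
    private. *)
Let disjoint_rows a a' b : a \notin S -> r a b -> r a' b -> a = a'.
Proof.
move=> Sa rab ra'b; apply/eqP; apply: contraNT Sa => /meetE.
rewrite inE lt0n; apply: contra_eqN => /eqP->.
by rewrite mul0n /= expn_eq0 andbT cards_eq0; apply/set0Pn; exists b; rewrite !inE rab.
Qed.

Let W_row a : a \in S -> R a \subset W.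
Proof.
move=> Sa; apply/subsetP => b; rewrite !inE => rab.
apply/forall_inP => a'; rewrite inE => nSa'; apply: contraL Sa => ra'b.
by rewrite -(disjoint_rows nSa' ra'b rab).
Qed.

(** The k - |S| singleton rows use as many of the k+1 columns. This count is what bounds every
    configuration below. *)
Let card_W : #|W| = #|S|.+1.
Proof.
have [c Rc] := fin_all_exists singleton_row.
have [[cA cB] _ _ _] := r_good.
have cinj : {in ~: S &, injective c}.
  move=> a a'; rewrite ![_ \in ~: _]inE => nSa nSa' ec.
  have rc b : b \notin S -> r b (c b).
    by move=> nSb; have /setP/(_ (c b)) := Rc b nSb; rewrite !inE eqxx.
  by apply: (disjoint_rows nSa (rc _ nSa)); rewrite ec; apply: rc.
have -> : W = ~: (c @: ~: S).
  apply/setP => b; rewrite !inE; apply/forall_inP/negP.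
    move=> Wb /imsetP[a nSa eb]; have /negP[] := Wb a nSa.
    rewrite in_setC in nSa; have /setP/(_ b) := Rc a nSa.
    by rewrite !inE eb eqxx.
  move=> nb a nSa; apply/negP => rab; apply: nb; apply/imsetP; exists a => //.
  rewrite in_setC in nSa; have /setP/(_ b) := Rc a nSa.
  by rewrite !inE rab => /esym/eqP.
by have := cardsC (c @: ~: S); have := cardsC S; rewrite card_in_imset// cA cB; lia.
Qed.

(** Only the incidences among non-singleton rows remain to be described: [w] and [u] attach columns
    to big and small rows, and [t] is the leftover column. V separates the sorts, as small rows lie
    inside it, big rows contain it, and it contains the values of [u] but not those of [w]; this
    settles the mixed blocks. If one sort is absent, V is taken empty or full. *)
Let label f (P Q : {set A}) (V : {set B}) (w u : A -> B) t :
  S = P :|: Q -> [disjoint P & Q] ->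
  {in Q, forall a, R a \subset V} -> {in P, forall a, V \subset R a} ->
  {in P &, injective w} -> {in Q &, injective u} ->
  {in P, forall a, [/\ w a \notin V, w a != t & w a \in W]} ->
  {in Q, forall a, [/\ u a \in V, u a != t & u a \in W]} -> t \in W ->
  {in P &, forall a c, r a (w c) =
     match f with KR | KQ => a == c | KH | KL => a != c | KG => false end} ->
  {in Q &, forall a c, r a (u c) =
     match f with KR | KH | KG => a == c | KQ | KL => a != c end} ->
  {in P, forall a, r a t = match f with KL => false | _ => true end} ->
  {in Q, forall a, r a t = match f with KR | KH | KG => true | _ => false end} ->
  giso (bip_graph r) (kind_graph f k #|P| #|Q|).
Proof.
move=> eS disj QV VP winj uinj wP uQ tW PP QQ PN QN.
have [c Rc] := fin_all_exists singleton_row.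
have rc a b : a \notin S -> r a b = (b == c a).
  by move=> nSa; have /setP/(_ b) := Rc a nSa; rewrite !inE.
have cW a : a \notin S -> c a \notin W.
  move=> nSa; rewrite inE negb_forall_in; apply/exists_inP; exists a.
    by rewrite in_setC.
  by rewrite negbK rc ?eqxx.
have nrW a b : a \notin S -> b \in W -> r a b = false.
  by move=> nSa; rewrite inE => /forall_inP/(_ a); rewrite in_setC => /(_ nSa)/negbTE.
have inS a : (a \in S) = (a \in P) || (a \in Q) by rewrite eS in_setU.
have QnP a : a \in Q -> (a \in P) = false by apply: disjointFl.
have PnQ a : a \in P -> (a \in Q) = false by apply: disjointFr.
pose h b := match b with
  | Some a => if a \in P then w a else if a \in Q then u a else c a | None => t end.
have hP a : a \in P -> h (Some a) = w a by rewrite /h => ->.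
have hQ a : a \in Q -> h (Some a) = u a by move=> Qa; rewrite /h QnP// Qa.
have hS a : a \notin S -> h (Some a) = c a.
  by rewrite inS => /norP[/negbTE nP /negbTE nQ]; rewrite /h nP nQ.
have [[cA cB] _ _ _] := r_good.
have S3 a : [\/ a \in P, a \in Q | a \notin S].
  by rewrite inS; case: (a \in P); case: (a \in Q);
    [apply: Or31 | apply: Or31 | apply: Or32 | apply: Or33].
apply: (giso_kind_graph (s := sort_of P Q) (h := h)) => //.
- by apply: eq_card => a; rewrite !inE /sort_of; do 2?case: ifP.
- apply: eq_card => a; rewrite !inE /sort_of; case: ifP => [/PnQ->//|_].
  by case: ifP.
- have auxt a : h (Some a) <> t.
    case: (S3 a) => aX; [rewrite hP//|rewrite hQ//|rewrite hS//] => e.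
    + by have [_ /eqP] := wP a aX.
    + by have [_ /eqP] := uQ a aX.
    + by have := cW a aX; rewrite e tW.
  case=> [a|] [a'|] // e; [congr Some|by have := auxt _ e|by have := auxt _ (esym e)].
  case: (S3 a) => aX; case: (S3 a') => a'X; move: e.
  + by rewrite !hP// => /winj->.
  + by rewrite hP// hQ// => e; have [] := wP a aX; have [uV _ _] := uQ a' a'X; rewrite e uV.
  + by rewrite hP// hS// => e; have [_ _] := wP a aX; rewrite e (negbTE (cW _ a'X)).
  + by rewrite hQ// hP// => e; have [] := wP a' a'X; have [uV _ _] := uQ a aX; rewrite -e uV.
  + by rewrite !hQ// => /uinj->.
  + by rewrite hQ// hS// => e; have [_ _] := uQ a aX; rewrite e (negbTE (cW _ a'X)).
  + by rewrite hS// hP// => e; have [_ _] := wP a' a'X; rewrite -e (negbTE (cW _ aX)).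
  + by rewrite hS// hQ// => e; have [_ _] := uQ a' a'X; rewrite -e (negbTE (cW _ aX)).
  + rewrite !hS// => e; apply: (@disjoint_rows a a' (c a)) => //; first by rewrite rc.
    by rewrite rc// e.
have sP a : a \in P -> sort_of P Q a = Some true by rewrite /sort_of => ->.
have sQ a : a \in Q -> sort_of P Q a = Some false by move=> Qa; rewrite /sort_of QnP// Qa.
have sN a : a \notin S -> sort_of P Q a = None.
  by rewrite inS => /norP[/negbTE nP /negbTE nQ]; rewrite /sort_of nP nQ.
move=> a [a'|]; last first.
  case: (S3 a) => aX /=.
  + by rewrite PN// sP//; case: (f).
  + by rewrite QN// sQ//; case: (f).
  + by rewrite nrW// sN//; case: (f).
case: (S3 a') => a'X.
- rewrite hP// /= sP//; have [wV _ wW] := wP a' a'X; case: (S3 a) => aX.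
  + by rewrite PP// sP//; case: (f).
  + have -> : r a (w a') = false.
      by apply: contraNF wV => raw; apply: (subsetP (QV a aX)); rewrite inE.
    have /negbTE -> : a != a' by apply: contraTneq aX => ->; rewrite PnQ.
    by rewrite sQ//; case: (f).
  + rewrite nrW// sN//; have /negbTE -> : a != a'.
      by apply: contraNneq aX => ->; rewrite inS a'X.
    by case: (f).
- rewrite hQ// /= sQ//; have [uV _ uW] := uQ a' a'X; case: (S3 a) => aX.
  + by rewrite sP//; have := subsetP (VP a aX) _ uV; rewrite inE => ->.
  + by rewrite QQ// sQ//; case: (f).
  + rewrite nrW// sN//; have /negbTE -> : a != a'.
      by apply: contraNneq aX => ->; rewrite inS a'X orbT.
    by case: (f).
rewrite hS// /= sN//.
have [->|naa'] := eqVneq; first by rewrite rc ?eqxx.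
apply: contraNF naa' => rac; rewrite eq_sym; apply/eqP.
by apply: disjoint_rows rac; rewrite ?rc ?eqxx.
Qed.


Let k_sum (P Q : {set A}) c d : S = P :|: Q -> [disjoint P & Q] ->
  {in P, forall a, x a = c} -> {in Q, forall a, x a = d} ->
  k = #|P| * c + #|Q| * d.
Proof.
move=> eS disj xP xQ; have [_ _ _ <-] := r_good.
rewrite -!sum_nat_const !(big_mkcond (fun a => a \in _)) -big_split /=.
apply: eq_bigr => a _; rewrite -/(x a).
have [aP|nP] := ifPn; first by rewrite xP// (disjointFr disj aP) addn0.
have [aQ|nQ] := ifPn; first by rewrite xQ.
have : a \notin S by rewrite eS inE negb_or nP.
by rewrite inE lt0n negbK => /eqP.
Qed.

Let meet_const a a' c : a != a' -> x a = c -> x a' = c -> #|R a :&: R a'| = c.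
Proof.
by move=> naa' xa xa'; apply/eqP; rewrite -(eqn_exp2r _ _ (isT : 0 < 2)) meetE// xa xa' mulnn.
Qed.

Let row_sub a a' : a \in S -> x a < x a' ->
  [/\ x a = 1, x a' = 4 & R a \subset R a'].
Proof.
rewrite inE => xa ltx; have naa' : a != a' by apply: contraTneq ltx => ->; rewrite ltnn.
have [|x1 x4 c2] := sqr_eq_mul_between xa ltx (meetE naa').
  by rewrite -cR; apply/subset_leq_card/subsetIl.
split=> //; apply/setIidPl/eqP; rewrite eqEcard subsetIl /=.
by rewrite c2 cR x1.
Qed.

Let S_gt0 : 0 < #|S|.
Proof.
rewrite card_gt0; apply: contraTneq k_gt0 => S0.
rewrite (@k_sum set0 set0 0 0) ?cards0// ?setU0//; try by move=> a; rewrite inE.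
by rewrite -setI_eq0 set0I.
Qed.

Let conclusion :=
  exists f p q, kind_params f k p q /\ giso (bip_graph r) (kind_graph f k p q).

(** A sunflower covers c + |S| points of W, which has |S| + 1, so c = 1 and the graph is the star. A
    cosunflower has |S| <= c + 2 <= |S| + 1. If |S| = c + 2, W has a point outside X, a zero column,
    and the kind is KL; if |S| = c + 1, some point of X is missed by no row, and the kind is KH. *)
Let const_case c : {in S, forall a, x a = c} -> conclusion.
Proof.
move=> xc; have disj : [disjoint S & set0] by rewrite -setI_eq0 setI0.
have ek : k = #|S| * c.
  by rewrite (k_sum _ disj xc (d := 0)) ?setU0// ?muln0 ?addn0// => a; rewrite inE.
have cRS : {in S, forall a, #|R a| = c.+1} by move=> a Sa; rewrite cR xc.
have cRI : {in S &, forall a a', a != a' -> #|R a :&: R a'| = c}.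
  by move=> a a' Sa Sa' naa'; apply: meet_const; rewrite ?xc.
have [[cA _] _ _ _] := r_good.
have leSk : #|S| <= k by rewrite -cA max_card.
have [||[K [w [[cK wK Rw winj] _]]]|[X [w [[cX wX Rw winj] S_gt2]]]] :=
  @uniform_family _ _ R S c cRS cRI set0 S_gt0.
- by rewrite cards0.
- by move=> a _; apply: sub0set.
- have wS b : (b \in w @: S) -> b \notin K by case/imsetP=> a Sa ->; apply: wK.
  have KW : K :|: w @: S \subset W.
    rewrite subUset; have [a Sa] := card_gt0P S_gt0; apply/andP; split.
      by apply: subset_trans (W_row Sa); rewrite Rw// subsetUr.
    by apply/subsetP => _ /imsetP[b Sb ->]; apply: (subsetP (W_row Sb)); rewrite Rw// setU11.
  have c1 : c = 1.
    have := subset_leq_card KW; rewrite card_W cardsU (_ : K :&: _ = set0).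
      rewrite cards0 cK card_in_imset//; move: k_gt0; rewrite ek; clear; nia.
    by apply/setP => b; rewrite !inE; apply/negbTE/andP => -[Kb /wS]; rewrite Kb.
  have /cards1P[t Kt] : #|K| == 1 by rewrite cK c1.
  have Sk : #|S| = k by rewrite ek c1 muln1.
  exists KR, 0, k; split; first by split; [rewrite add0n | left].
  rewrite -(cards0 A) -[in X in kind_graph _ _ _ X]Sk.
  have rE : {in S, forall a b, r a b = (b == w a) || (b == t)}.
    by move=> a Sa b; have /setP/(_ b) := Rw a Sa; rewrite Kt !inE.
  have wt : {in S, forall a, w a != t} by move=> a /wK; rewrite Kt inE.
  have tK : t \in K by rewrite Kt inE.
  apply: (@label KR set0 S setT w w t) => //; try by move=> a; rewrite inE.
  + by rewrite set0U.
  + by rewrite -setI_eq0 set0I.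
  + move=> a Sa; rewrite inE wt//; split=> //.
    by apply: (subsetP KW); rewrite inE imset_f ?orbT.
  + by apply: (subsetP KW); rewrite inE tK.
  + by move=> a a' Sa Sa'; rewrite rE// (negbTE (wt _ Sa')) orbF (inj_in_eq winj)// eq_sym.
  + by move=> a Sa; rewrite rE// eqxx orbT.
have rE : {in S, forall a b, r a b = (b != w a) && (b \in X)}.
  by move=> a Sa b; have /setP/(_ b) := Rw a Sa; rewrite !inE.
have XW : X \subset W.
  have [a [a' [Sa Sa' naa']]] := card_gt1P (ltnW S_gt2).
  apply/subsetP => b Xb; have [eb|nb] := eqVneq b (w a).
    apply: (subsetP (W_row Sa')); rewrite Rw// !inE Xb andbT eb.
    by rewrite (inj_in_eq winj).
  by apply: (subsetP (W_row Sa)); rewrite Rw// !inE nb.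
have wSX : w @: S \subset X by apply/subsetP => _ /imsetP[a Sa ->]; apply: wX.
have leX := subset_leq_card XW; have lewX := subset_leq_card wSX.
rewrite card_W cX in leX; rewrite cX card_in_imset// in lewX.
have lab f t : t \in W -> {in S, forall a, w a != t} ->
    (f = KH /\ t \in X \/ f = KL /\ t \notin X) -> giso (bip_graph r) (kind_graph f k #|S| 0).
  move=> tW wt ft; rewrite -(cards0 A).
  apply: (@label f S set0 set0 w w t) => //; try by move=> a; rewrite inE.
  + by rewrite setU0.
  + by move=> a Sa; apply: sub0set.
  + by move=> a Sa; rewrite inE wt//; split=> //; apply: (subsetP XW); apply: wX.
  + move=> a a' Sa Sa'; rewrite rE// wX// andbT (inj_in_eq winj)// eq_sym.
    by case: ft => -[-> _].
  + move=> a Sa; rewrite rE// eq_sym wt//=.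
    by case: ft => -[-> tX] //; apply: negbTE.
have [eS|neS] := eqVneq #|S| c.+2.
  have [t tW tX] : exists2 t, t \in W & t \notin X.
    by apply/subsetPn; apply/negP => /subset_leq_card; rewrite card_W cX eS ltnn.
  exists KL, #|S|, 0; split.
    split; first by rewrite addn0.
    by left; split=> //; rewrite ek eS subn2.
  apply: (lab KL t tW); last by right.
  by move=> a /wX; apply: contraTneq => ->.
have eS : #|S| = c.+1 by move: neS leX lewX; clear; lia.
have [t tX tw] : exists2 t, t \in X & t \notin w @: S.
  by apply/subsetPn; apply/negP => /subset_leq_card; rewrite card_in_imset// cX eS ltnn.
exists KH, #|S|, 0; split.
  split; first by rewrite addn0.
  by left; split=> //; rewrite ek eS subn1.
apply: (lab KH t _ _); [exact: (subsetP XW) | | by left].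
by move=> a Sa; apply: contraNneq tw => <-; apply: imset_f.
Qed.


(** * Rows of both sizes 2 and 5 *)

Section Mixed.

Variables a1 a2 : A.
Hypotheses (Sa1 : a1 \in S) (ltx12 : x a1 < x a2).

Let P := [set a | x a == 4].
Let Q := [set a | x a == 1].
Let V := \bigcup_(a in Q) R a.

Let Pa2 : a2 \in P.
Proof. by have [_ x4 _] := row_sub Sa1 ltx12; rewrite inE x4. Qed.

Let Qa1 : a1 \in Q.
Proof. by have [x1 _ _] := row_sub Sa1 ltx12; rewrite inE x1. Qed.

Let eS : S = P :|: Q.
Proof.
apply/setP => a; apply/idP/idP; last first.
  by rewrite !inE => /orP[] /eqP->.
move=> Sa; rewrite !inE; have [_|nx1] := eqVneq (x a) 1; rewrite ?orbT// orbF.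
have x1 : x a1 = 1 by have [] := row_sub Sa1 ltx12.
have [|_ -> //] := @row_sub a1 a Sa1.
by rewrite x1; move: Sa nx1; rewrite inE; case: (x a) => [|[]].
Qed.

Let disjPQ : [disjoint P & Q].
Proof.
rewrite -setI_eq0; apply/eqP/setP => a; rewrite !inE.
by case: (x a) => [|[|n]]; rewrite ?andbF.
Qed.

Let xP : {in P, forall a, x a = 4}. Proof. by move=> a; rewrite inE => /eqP. Qed.
Let xQ : {in Q, forall a, x a = 1}. Proof. by move=> a; rewrite inE => /eqP. Qed.

Let PS a : a \in P -> a \in S. Proof. by rewrite eS in_setU => ->. Qed.
Let QS a : a \in Q -> a \in S. Proof. by rewrite eS in_setU orbC => ->. Qed.

Let card_S : #|S| = #|P| + #|Q|.
Proof. by rewrite eS cardsU disjoint_setI0// cards0 subn0. Qed.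

Let ek : k = #|P| * 4 + #|Q|.
Proof. by rewrite (k_sum eS disjPQ xP xQ) muln1. Qed.

Let P_gt0 : 0 < #|P|. Proof. by apply/card_gt0P; exists a2. Qed.
Let Q_gt0 : 0 < #|Q|. Proof. by apply/card_gt0P; exists a1. Qed.

Let QV : {in Q, forall a, R a \subset V}.
Proof. by move=> a Qa; apply: bigcup_sup. Qed.

Let VP : {in P, forall a, V \subset R a}.
Proof.
move=> a Pa; apply/bigcupsP => a' Qa'.
by have [|] := @row_sub a' a (QS Qa') => //; rewrite xQ// xP.
Qed.

Let VW : V \subset W.
Proof. by apply/bigcupsP => a Qa; apply/W_row/QS. Qed.

(** Pairs that meet pairwise in one point are the edges of a star with centre t or of a triangle. *)
Let smalls :
  (exists u t, [/\ #|V| = #|Q|.+1, t \in V, {in Q, forall a, u a \in V /\ u a != t},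
      {in Q, forall a b, r a b = (b == u a) || (b == t)} & {in Q &, injective u}]) \/
  (exists u, [/\ #|V| = 3, #|Q| = 3, {in Q, forall a, u a \in V},
      {in Q, forall a b, r a b = (b != u a) && (b \in V)} & {in Q &, injective u}]).
Proof.
have cRQ : {in Q, forall a, #|R a| = 2} by move=> a Qa; rewrite cR xQ.
have cRI : {in Q &, forall a a', a != a' -> #|R a :&: R a'| = 1}.
  by move=> a a' Qa Qa' naa'; apply: meet_const; rewrite ?xQ.
have [||[K [u [[/eqP/cards1P[t Kt] uK Ru uinj] _]]]|[X [u [[cX uX Ru uinj] Q_gt2]]]] :=
  @uniform_family _ _ R Q 1 cRQ cRI set0 Q_gt0.
- by rewrite cards0.
- by move=> a _; apply: sub0set.
- left; exists u, t.
  have ut : {in Q, forall a, u a != t} by move=> a /uK; rewrite Kt inE.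
  have rE : {in Q, forall a b, r a b = (b == u a) || (b == t)}.
    by move=> a Qa b; have /setP/(_ b) := Ru a Qa; rewrite Kt !inE.
  have inV a b : a \in Q -> r a b -> b \in V.
    by move=> Qa rab; apply/bigcupP; exists a; rewrite // inE.
  have eV : V = t |: u @: Q.
    apply/setP => b; rewrite in_setU1; apply/bigcupP/idP => [[a Qa]|].
      by rewrite inE rE// => /orP[]/eqP-> ; rewrite ?eqxx// imset_f ?orbT.
    case/orP=> [/eqP->|/imsetP[a Qa ->]].
      by exists a1; rewrite // inE rE// eqxx orbT.
    by exists a; rewrite // inE rE// eqxx.
  split=> //.
  + rewrite eV cardsU1 card_in_imset// (_ : t \notin _) ?add1n//.
    by apply/imsetP => -[a Qa et]; have := ut a Qa; rewrite et eqxx.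
  + by rewrite eV setU11.
  + by move=> a Qa; split; [rewrite eV inE imset_f ?orbT | apply: ut].
right; exists u.
have uXsub : u @: Q \subset X by apply/subsetP => _ /imsetP[a Qa ->]; apply: uX.
have cQ : #|Q| = 3.
  by apply/eqP; rewrite eqn_leq Q_gt2 andbT -cX -(card_in_imset uinj) subset_leq_card.
have eX : X = u @: Q.
  by apply/esym/eqP; rewrite eqEcard uXsub card_in_imset// cX cQ.
have eV : V = X.
  apply/setP => b; apply/bigcupP/idP => [[a Qa]|]; first by rewrite Ru// inE => /andP[].
  rewrite eX => /imsetP[a Qa ->].
  have /card_gt0P[a'] : 0 < #|Q :\ a| by rewrite -(ltn_add2l (a \in Q)) -cardsD1 Qa ltnW.
  rewrite !inE => /andP[na'a Qa'']; have Qa' : a' \in Q by rewrite inE.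
  by exists a'; rewrite // Ru// !inE uX// andbT (inj_in_eq uinj)// eq_sym.
split=> //; rewrite ?eV//.
by move=> a Qa b; have /setP/(_ b) := Ru a Qa; rewrite !inE.
Qed.

(** The bound on V is the one under which the core of a sunflower of big rows can be chosen to
    contain V. In a cosunflower the missing points [w a] avoid V, since each big row contains V. *)
Let bigs : #|V| <= 4 ->
  (exists (K : {set B}) w, [/\ #|K| = 4, V \subset K /\ K \subset W, 4 + #|P| <= #|S|.+1,
      {in P, forall a, w a \notin K /\ w a \in W} &
      {in P, forall a b, r a b = (b == w a) || (b \in K)} /\ {in P &, injective w}]) \/
  (exists (X : {set B}) w, [/\ #|X| = 6, X \subset W, 2 < #|P|,
      {in P, forall a, w a \in X} /\ V \subset X :\: (w @: P) &
      {in P, forall a b, r a b = (b != w a) && (b \in X)} /\ {in P &, injective w}]).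
Proof.
move=> V4.
have cRP : {in P, forall a, #|R a| = 5} by move=> a Pa; rewrite cR xP.
have cRI : {in P &, forall a a', a != a' -> #|R a :&: R a'| = 4}.
  by move=> a a' Pa Pa' naa'; apply: meet_const; rewrite ?xP.
have [[K [w [[cK wK Rw winj] VK]]]|[X [w [[cX wX Rw winj] P_gt2]]]] :=
  @uniform_family _ _ R P 4 cRP cRI V P_gt0 V4 VP.
  left; exists K, w.
  have KW : K \subset W by apply: subset_trans (W_row (PS Pa2)); rewrite Rw// subsetUr.
  have wW : {in P, forall a, w a \in W}.
    by move=> a Pa; apply: (subsetP (W_row (PS Pa))); rewrite Rw// setU11.
  split=> //.
  - have : K :|: w @: P \subset W.
      by rewrite subUset KW; apply/subsetP => _ /imsetP[a Pa ->]; apply: wW.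
    move/subset_leq_card; rewrite card_W cardsU cK card_in_imset//.
    rewrite (_ : K :&: _ = set0) ?cards0 ?subn0//.
    apply/setP => b; rewrite in_setI in_set0; apply/negbTE/andP => -[Kb /imsetP[a Pa eb]].
    by have := wK a Pa; rewrite -eb Kb.
  - by move=> a Pa; split; [apply: wK | apply: wW].
  - by split=> // a Pa b; have /setP/(_ b) := Rw a Pa; rewrite !inE.
right; exists X, w.
have XW : X \subset W.
  have [a [a' [Pa Pa' naa']]] := card_gt1P (ltnW P_gt2).
  apply/subsetP => b Xb; have [eb|nb] := eqVneq b (w a).
    apply: (subsetP (W_row (PS Pa'))); rewrite Rw// !inE Xb andbT eb.
    by rewrite (inj_in_eq winj).
  by apply: (subsetP (W_row (PS Pa))); rewrite Rw// !inE nb.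
split=> //.
- split=> //; apply/subsetP => b Vb; rewrite inE; apply/andP; split.
    apply/imsetP => -[a Pa eb]; have := subsetP (VP Pa) b Vb.
    by rewrite Rw// !inE eb eqxx.
  by have := subsetP (VP Pa2) b Vb; rewrite Rw// !inE => /andP[].
- by split=> // a Pa b; have /setP/(_ b) := Rw a Pa; rewrite !inE.
Qed.

Let lab f w u t := @label f P Q V w u t eS disjPQ QV VP.

Lemma mixed_case : conclusion.
Proof.
have tVW t : t \in V -> t \in W by apply: subsetP.
have leSk : #|P| + #|Q| <= k by rewrite ek; clear; lia.
have cS1 := card_W; rewrite card_S in cS1.
have [V4|V5] := leqP #|V| 4.
  have [[u [t [cV tV uV rQ uinj]]] | [u [cV cQ uV rQ uinj]]] := smalls;
  have [[K [w [cK [VK KW] leP wK [rP winj]]]] | [X [w [cX XW P_gt2 [wX VX] [rP winj]]]]] :=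
    bigs V4.
  (* Star and sunflower: the core gives 4 + |P| <= |P| + |Q| + 1, while |Q| + 1 = |V| <= 4. *)
  - have cQ : #|Q| = 3 by move: leP V4; rewrite card_S cV; clear; lia.
    exists KR, #|P|, #|Q|; split; first by split=> //; right; rewrite ek cQ mulnC.
    apply: (lab (w := w) (u := u) (t := t)) => //.
    + move=> a Pa; have [wKa ?] := wK a Pa; have wV : w a \notin V.
        by apply: contra wKa; apply: subsetP.
      by split=> //; apply: contraNneq wV => ->.
    + by move=> a Qa; have [uVa ut] := uV a Qa; split=> //; apply: tVW.
    + exact: tVW.
    + move=> a c Pa Pc; rewrite rP// (negbTE (proj1 (wK c Pc))) orbF.
      by rewrite (inj_in_eq winj)// eq_sym.
    + move=> a c Qa Qc; rewrite rQ// (negbTE (proj2 (uV c Qc))) orbF.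
      by rewrite (inj_in_eq uinj)// eq_sym.
    + by move=> a Pa; rewrite rP// (subsetP VK _ tV) orbT.
    + by move=> a Qa; rewrite rQ// eqxx orbT.
  (* Star and cosunflower: |Q| + 1 <= 6 - |P| and 6 <= |P| + |Q| + 1 give |P| + |Q| = 5. With |P| >
     2 and Q nonempty, (3, 2) and (4, 1) remain. *)
  - have VX6 := subset_leq_card VX; have X6 := subset_leq_card XW.
    have wSX : w @: P \subset X by apply/subsetP => _ /imsetP[a Pa ->]; apply: wX.
    rewrite cardsD (setIidPr wSX) card_in_imset// cX cV in VX6.
    rewrite cS1 cX in X6.
    exists KH, #|P|, #|Q|; split.
      split=> //; rewrite ek; move: P_gt2 Q_gt0 VX6 X6; clear.
      by move: #|P| #|Q| => p q *; right; lia.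
    apply: (lab (w := w) (u := u) (t := t)) => //.
    + move=> a Pa; have wV : w a \notin V.
        apply/negP => /(subsetP VX); rewrite inE => /andP[/negP[]].
        exact: imset_f.
      split=> //; first by apply: contraNneq wV => ->.
      by apply: (subsetP XW); apply: wX.
    + by move=> a Qa; have [uVa ut] := uV a Qa; split=> //; apply: tVW.
    + exact: tVW.
    + by move=> a c Pa Pc; rewrite rP// wX// andbT (inj_in_eq winj)// eq_sym.
    + move=> a c Qa Qc; rewrite rQ// (negbTE (proj2 (uV c Qc))) orbF.
      by rewrite (inj_in_eq uinj)// eq_sym.
    + move=> a Pa; have := subsetP VX _ tV; rewrite rP// inE => /andP[nt ->].
      by rewrite andbT; apply: contraNneq nt => ->; apply: imset_f.
    + by move=> a Qa; rewrite rQ// eqxx orbT.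
  (* Triangle and sunflower: the core has one point more than the triangle, and this is the leftover
     column. *)
  - have [t tK tV] : exists2 t, t \in K & t \notin V.
      by apply/subsetPn; apply/negP => /subset_leq_card; rewrite cK cV.
    exists KQ, #|P|, #|Q|; split; first by split=> //; rewrite ek cQ mulnC.
    apply: (lab (w := w) (u := u) (t := t)) => //.
    + move=> a Pa; have [wKa ?] := wK a Pa; split=> //.
        by apply: contra wKa; apply: subsetP.
      by apply: contraNneq wKa => ->.
    + move=> a Qa; have uVa := uV a Qa; split=> //; last exact: tVW.
      by apply: contraNneq tV => <-.
    + exact: (subsetP KW).
    + move=> a c Pa Pc; rewrite rP// (negbTE (proj1 (wK c Pc))) orbF.
      by rewrite (inj_in_eq winj)// eq_sym.
    + by move=> a c Qa Qc; rewrite rQ// uV// andbT (inj_in_eq uinj)// eq_sym.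
    + by move=> a Pa; rewrite rP// tK orbT.
    + by move=> a Qa; rewrite rQ// (negbTE tV) andbF.
  (* Triangle and cosunflower: 3 <= 6 - |P| and |P| > 2 give |P| = 3; W has 7 points, so one lies
     outside X and is a zero column. *)
  - have VX6 := subset_leq_card VX.
    have wSX : w @: P \subset X by apply/subsetP => _ /imsetP[a Pa ->]; apply: wX.
    rewrite cardsD (setIidPr wSX) card_in_imset// cX cV in VX6.
    have cP : #|P| = 3 by move: P_gt2 VX6; clear; lia.
    have [t tW tX] : exists2 t, t \in W & t \notin X.
      by apply/subsetPn; apply/negP => /subset_leq_card; rewrite cS1 cX cP cQ.
    have VsubX : V \subset X by apply: subset_trans VX (subsetDl _ _).
    exists KL, #|P|, #|Q|; split.
      by split=> //; right; rewrite ek cP cQ.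
    apply: (lab (w := w) (u := u) (t := t)) => //.
    + move=> a Pa; split; last by apply: (subsetP XW); apply: wX.
        apply/negP => /(subsetP VX); rewrite inE => /andP[/negP[]].
        exact: imset_f.
      by apply: contraNneq tX => <-; apply: wX.
    + move=> a Qa; have uVa := uV a Qa; split=> //; last exact: tVW.
      by apply: contraNneq tX => <-; apply: (subsetP VsubX).
    + by move=> a c Pa Pc; rewrite rP// wX// andbT (inj_in_eq winj)// eq_sym.
    + by move=> a c Qa Qc; rewrite rQ// uV// andbT (inj_in_eq uinj)// eq_sym.
    + by move=> a Pa; rewrite rP// (negbTE tX) andbF.
    + move=> a Qa; rewrite rQ//; apply/negbTE; rewrite negb_and orbC.
      by rewrite (contra (subsetP VsubX t)).
(* If |V| >= 5, every big row equals V. Two of them would meet in 5 points instead of 4, so there is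
   only one, and the point of W outside V is a zero column. *)
have [[u [t [cV tV uV rQ uinj]]] | [u [cV _ _ _ _]]] := smalls; last by rewrite cV in V5.
have RV : {in P, forall a, R a = V}.
  by move=> a Pa; apply/esym/eqP; rewrite eqEcard VP//= cR xP.
have cQ : #|Q| = 4.
  have := cR a2; rewrite RV// xP// cV; clear; lia.
have cP : #|P| = 1.
  apply/eqP; rewrite eqn_leq P_gt0 andbT; apply/card_le1_eqP => a a' Pa Pa'.
  apply/eqP/negP => /negP naa'; have := meet_const naa' (xP Pa') (xP Pa).
  by rewrite !RV// setIid cV cQ.
have [z zW zV] : exists2 z, z \in W & z \notin V.
  by apply/subsetPn; apply/negP => /subset_leq_card; rewrite cS1 cV cP cQ.
exists KG, #|P|, #|Q|; split.
  by split=> //; rewrite ek cP cQ.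
apply: (lab (w := fun=> z) (u := u) (t := t)) => //.
- move=> a a' Pa Pa' _; have /card_le1_eqP P1 : #|P| <= 1 by rewrite cP.
  exact: P1.
- by move=> a Pa; split=> //; apply: contraNneq zV => ->.
- by move=> a Qa; have [uVa ut] := uV a Qa; split=> //; apply: tVW.
- exact: tVW.
- by move=> a c Pa Pc; have /setP/(_ z) := RV a Pa; rewrite inE (negbTE zV).
- move=> a c Qa Qc; rewrite rQ// (negbTE (proj2 (uV c Qc))) orbF.
  by rewrite (inj_in_eq uinj)// eq_sym.
- by move=> a Pa; have /setP/(_ t) := RV a Pa; rewrite inE tV.
- by move=> a Qa; rewrite rQ// eqxx orbT.
Qed.

End Mixed.

Theorem good_classification :
  exists f p q, kind_params f k p q /\ giso (bip_graph r) (kind_graph f k p q).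
Proof.
have [a0 Sa0] := card_gt0P S_gt0.
have [/forall_inP xc|] := boolP [forall a in S, x a == x a0].
  by apply: (@const_case (x a0)) => a /xc/eqP.
rewrite negb_forall_in => /exists_inP[a Sa]; rewrite neq_ltn => /orP[] ltx.
  exact: mixed_case Sa ltx.
exact: mixed_case Sa0 ltx.
Qed.

End Classification.

(** * The graphs of the statement *)

Lemma giso_gunionl G G' H : giso G G' -> giso (G \cup H) (G' \cup H).
Proof.
case=> f [g fK gK] fadj.
exists (fun u : G + H => match u with inl x => inl (f x) | inr y => inr y end).
  exists (fun u : G' + H => match u with inl x => inl (g x) | inr y => inr y end).
    by case=> x; rewrite ?fK.
  by case=> x; rewrite ?gK.
by case=> x [] y //=.
Qed.

Lemma giso_mK2_0 G : giso (G \cup mK2 0) G.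
Proof.
apply: giso_sym; exists (fun x : G => inl x : G \cup mK2 0) => //.
apply: inj_card_bij => [x y []//|].
by rewrite card_sum card_prod card_ord mul0n addn0.
Qed.

(** Adding m copies of K_2 appends an identity block to the bipartite adjacency matrix; [add_col]
    appends the zero column that stands for K_1. *)
Definition sum_id (A B : Type) (r : A -> B -> bool) m (u : A + 'I_m) (v : B + 'I_m) :=
  match u, v with
  | inl a, inl b => r a b
  | inr i, inr j => i == j
  | _, _ => false
  end.

Definition add_col (A B : Type) (r : A -> B -> bool) (a : A) (b : option B) :=
  if b is Some b' then r a b' else false.

Lemma giso_mK2 (A B : finType) (r : A -> B -> bool) m :
  giso (bip_graph r \cup mK2 m) (bip_graph (@sum_id A B r m)).
Proof.
pose F (u : (A + B) + 'I_m * 'I_2) : (A + 'I_m) + (B + 'I_m) :=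
  match u with
  | inl (inl a) => inl (inl a)
  | inl (inr b) => inr (inl b)
  | inr (i, e) => if e == ord0 then inl (inr i) else inr (inr i)
  end.
have I2 (e e' : 'I_2) : (e == ord0) = (e' == ord0) -> e = e'.
  by move=> ee; apply: val_inj; case: e e' ee => [[|[|?]] ?] [[|[|?]] ?].
apply: (@giso_inj (bip_graph r \cup mK2 m) (bip_graph (@sum_id A B r m)) F).
- case=> [[a|b]|[i e]] [[a'|b']|[i' e']] //=; try by [case: ifP | move=> [->]].
  case: ifP => e0; case: ifP => e'0 // [->]; congr (inr (_, _)); apply: I2;
    by rewrite e0 e'0.
- by rewrite !card_sum card_prod !card_ord; lia.
case=> [[a|b]|[i e]] [[a'|b']|[i' e']] //=; try by case: ifP.
rewrite /copies_rel /=; case: (e =P e') => [->|ne]; first by case: ifP; rewrite andbF.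
rewrite andbT; case: ifP => e0; case: ifP => e'0 //=; try by rewrite eq_sym.
  by case: ne; apply: I2; rewrite e0 e'0.
by case: ne; apply: I2; rewrite e0 e'0.
Qed.

Lemma giso_K1 (A B : finType) (r : A -> B -> bool) :
  giso (bip_graph r \cup K1) (bip_graph (add_col r)).
Proof.
pose F (u : (A + B) + 'I_1) : A + option B :=
  match u with
  | inl (inl a) => inl a
  | inl (inr b) => inr (Some b)
  | inr _ => inr None
  end.
apply: (@giso_inj (bip_graph r \cup K1) (bip_graph (add_col r)) F).
- by case=> [[a|b]|i] [[a'|b']|i'] //= => [[->]|[->]|_] //; rewrite !ord1.
- by rewrite !card_sum card_option card_ord; lia.
by case=> [[a|b]|i] [[a'|b']|i'] //=; rewrite !ord1 eqxx.
Qed.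

Lemma giso_mK2_K1 (A B : finType) (r : A -> B -> bool) m :
  giso (bip_graph r \cup mK2 m \cup K1) (bip_graph (add_col (@sum_id A B r m))).
Proof. exact: giso_trans (giso_gunionl _ (giso_mK2 r m)) (giso_K1 _). Qed.

Lemma giso_calH l :
  giso (calH l) (bip_graph (fun (i : 'I_l) (j : option 'I_l) =>
                              if j is Some j' then i != j' else true)).
Proof.
pose F (u : option ('I_l + 'I_l)) : 'I_l + option 'I_l :=
  match u with
  | Some (inl i) => inl i
  | Some (inr j) => inr (Some j)
  | None => inr None
  end.
apply: (@giso_inj (calH l) (bip_graph _) F).
- by case=> [[a|b]|] [[a'|b']|] //= [->].
- by rewrite card_option !card_sum card_option; lia.
by case=> [[a|b]|] [[a'|b']|].
Qed.

Section BlockMatrices.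
Local Open Scope ring_scope.

Definition sum_rel (A1 A2 B1 B2 : Type) (r11 : A1 -> B1 -> bool) (r12 : A1 -> B2 -> bool)
    (r21 : A2 -> B1 -> bool) (r22 : A2 -> B2 -> bool) (u : A1 + A2) (v : B1 + B2) :=
  match u, v with
  | inl a, inl b => r11 a b | inl a, inr b => r12 a b
  | inr a, inl b => r21 a b | inr a, inr b => r22 a b
  end.

Definition mx_rel m n (M : 'M[int]_(m, n)) i j := M i j == 1.

Lemma giso_block_mx m1 m2 n1 n2 (M11 : 'M[int]_(m1, n1)) (M12 : 'M[int]_(m1, n2))
    (M21 : 'M[int]_(m2, n1)) (M22 : 'M[int]_(m2, n2)) :
  giso (bip_of_mx (block_mx M11 M12 M21 M22))
    (bip_graph (sum_rel (mx_rel M11) (mx_rel M12) (mx_rel M21) (mx_rel M22))).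
Proof.
apply: giso_sym; apply: (giso_bip (f := @unsplit m1 m2) (h := @unsplit n1 n2)).
- by exists (@split m1 m2); [apply: unsplitK | apply: splitK].
- by exists (@split n1 n2); [apply: unsplitK | apply: splitK].
by move=> [i|i] [j|j] /=; rewrite ?block_mxEul ?block_mxEur ?block_mxEdl ?block_mxEdr.
Qed.

Lemma Imx_eq1 n (i j : 'I_n) : mx_rel (Imx n) i j = (i == j).
Proof. by rewrite /mx_rel mxE; case: (i == j). Qed.

Lemma Jmx_eq1 m n (i : 'I_m) (j : 'I_n) : mx_rel (Jmx m n) i j = true.
Proof. by rewrite /mx_rel mxE. Qed.

Lemma JmI_eq1 n (i j : 'I_n) : mx_rel (JmI n) i j = (i != j).
Proof. by rewrite /mx_rel !mxE; case: (i == j). Qed.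

Lemma mx0_eq1 m n (i : 'I_m) (j : 'I_n) : mx_rel 0 i j = false.
Proof. by rewrite /mx_rel mxE. Qed.

Lemma Itilde_eq1l n (i j : 'I_n) : mx_rel (Itilde n) i (lshift 1 j) = (i == j).
Proof. by rewrite /mx_rel row_mxEl mxE; case: (i == j). Qed.

Lemma Itilde_eq1r n (i : 'I_n) (j : 'I_1) : mx_rel (Itilde n) i (rshift n j) = true.
Proof. by rewrite /mx_rel row_mxEr mxE. Qed.

End BlockMatrices.

Definition mx_relE := (Imx_eq1, Jmx_eq1, JmI_eq1, mx0_eq1, Itilde_eq1l, Itilde_eq1r).

Lemma nsort_sum (A1 A2 : finType) (s : A1 + A2 -> option bool) x :
  nsort s x = nsort (s \o inl) x + nsort (s \o inr) x.
Proof. by rewrite /nsort -!sum1_card big_sumType. Qed.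

Lemma nsort_const (A : finType) y x : nsort (fun _ : A => y) x = (y == x) * #|A|.
Proof.
rewrite /nsort; case: (y == x); last by rewrite mul0n; apply: eq_card0.
by rewrite mul1n; apply: eq_card.
Qed.

Definition sort3 (A1 A2 A3 : Type) (u : A1 + A2 + A3) : option bool :=
  match u with
  | inl (inl _) => Some true | inl (inr _) => Some false | inr _ => None end.

Lemma nsort3 (A1 A2 A3 : finType) x : nsort (@sort3 A1 A2 A3) x =
  (Some true == x) * #|A1| + (Some false == x) * #|A2| + (None == x) * #|A3|.
Proof. by rewrite !nsort_sum !nsort_const. Qed.

Definition sort2 (A1 A2 : Type) y (u : A1 + A2) : option bool :=
  match u with inl _ => Some y | inr _ => None end.

Lemma nsort2 (A1 A2 : finType) y x : nsort (@sort2 A1 A2 y) x =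
  (Some y == x) * #|A1| + (None == x) * #|A2|.
Proof. by rewrite !nsort_sum !nsort_const. Qed.

Lemma giso_calR n m :
  giso (calR n \cup mK2 m) (kind_graph KR (n./2 - 3 + 3 + m) (n./2 - 3) 3).
Proof.
rewrite /calR; set p := n./2 - 3.
apply: giso_trans (giso_trans (giso_gunionl _ (giso_block_mx _ _ _ _)) (giso_mK2 _ _)) _.
pose h (u : option ('I_p + 'I_3 + 'I_m)) : 'I_p + 'I_(3 + 1) + 'I_m :=
  match u with
  | Some (inl (inl i)) => inl (inl i)
  | Some (inl (inr i)) => inl (inr (lshift 1 i))
  | Some (inr i) => inr i
  | None => inl (inr (rshift 3 ord0))
  end.
apply: (giso_kind_graph (s := @sort3 _ _ _) (h := h)).
- by rewrite !card_sum !card_ord.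
- by rewrite !card_sum !card_ord; lia.
- by rewrite nsort3 !card_ord !eqE /=; lia.
- by rewrite nsort3 !card_ord !eqE /=; lia.
- case=> [[[i|i]|i]|] [[[j|j]|j]|] //= []; try by [move=> -> | move=> /val_inj->].
    by move=> e; have := ltn_ord i; rewrite e.
  by move=> e; have := ltn_ord j; rewrite -e.
by case=> [[i|i]|i] [[[j|j]|j]|] //=; rewrite ?mx_relE.
Qed.

Lemma giso_calQ n m :
  giso (calQ n \cup mK2 m) (kind_graph KQ (n./2 - 3 + 3 + m) (n./2 - 3) 3).
Proof.
rewrite /calQ; set p := n./2 - 3.
apply: giso_trans (giso_trans (giso_gunionl _ (giso_block_mx _ _ _ _)) (giso_mK2 _ _)) _.
pose h (u : option ('I_p + 'I_3 + 'I_m)) : 'I_(p + 1) + 'I_3 + 'I_m :=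
  match u with
  | Some (inl (inl i)) => inl (inl (lshift 1 i))
  | Some (inl (inr i)) => inl (inr i)
  | Some (inr i) => inr i
  | None => inl (inl (rshift p ord0))
  end.
apply: (giso_kind_graph (s := @sort3 _ _ _) (h := h)).
- by rewrite !card_sum !card_ord.
- by rewrite !card_sum !card_ord; lia.
- by rewrite nsort3 !card_ord !eqE /=; lia.
- by rewrite nsort3 !card_ord !eqE /=; lia.
- case=> [[[i|i]|i]|] [[[j|j]|j]|] //= []; try by [move=> -> | move=> /val_inj->].
    by move=> e; have := ltn_ord i; rewrite e addn0 ltnn.
  by move=> e; have := ltn_ord j; rewrite -e addn0 ltnn.
by case=> [[i|i]|i] [[[j|j]|j]|] //=; rewrite ?mx_relE.
Qed.

Lemma giso_calH_mK2 l m : giso (calH l \cup mK2 m) (kind_graph KH (l + m) l 0).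
Proof.
apply: giso_trans (giso_trans (giso_gunionl _ (giso_calH _)) (giso_mK2 _ _)) _.
pose h (u : option ('I_l + 'I_m)) : option 'I_l + 'I_m :=
  match u with
  | Some (inl i) => inl (Some i) | Some (inr i) => inr i | None => inl None end.
apply: (giso_kind_graph (s := @sort2 _ _ true) (h := h)).
- by rewrite card_sum !card_ord.
- by rewrite card_sum card_option !card_ord.
- by rewrite nsort2 !card_ord !eqE /=; lia.
- by rewrite nsort2 !card_ord !eqE /=; lia.
- by case=> [[i|i]|] [[j|j]|] //= [] ->.
by case=> [i|i] [[j|j]|] //=.
Qed.

Lemma giso_calL_mK2 l m :
  giso (calL l \cup mK2 m \cup K1) (kind_graph KL (l + m) l 0).
Proof.
apply: giso_trans (giso_mK2_K1 _ _) _.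
pose h (u : option ('I_l + 'I_m)) : option ('I_l + 'I_m) := u.
apply: (giso_kind_graph (s := @sort2 _ _ true) (h := h)).
- by rewrite card_sum !card_ord.
- by rewrite card_option card_sum !card_ord.
- by rewrite nsort2 !card_ord !eqE /=; lia.
- by rewrite nsort2 !card_ord !eqE /=; lia.
- by [].
by case=> [i|i] [[j|j]|] //=.
Qed.

Lemma giso_G1 m : giso (G1 \cup mK2 m \cup K1) (kind_graph KG (1 + 4 + m) 1 4).
Proof.
apply: giso_trans (giso_gunionl _ (giso_gunionl _ (giso_block_mx _ _ _ _))) _.
apply: giso_trans (giso_mK2_K1 _ _) _.
(* The first column of G_1 is all ones and plays [None]; the zero column coming from K_1 is attached
   to the big row. *)
pose h (u : option ('I_1 + 'I_4 + 'I_m)) : option ('I_1 + 'I_4 + 'I_m) :=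
  match u with
  | Some (inl (inl i)) => None
  | None => Some (inl (inl ord0))
  | _ => u
  end.
apply: (giso_kind_graph (s := @sort3 _ _ _) (h := h)).
- by rewrite !card_sum !card_ord.
- by rewrite card_option !card_sum !card_ord.
- by rewrite nsort3 !card_ord !eqE /=; lia.
- by rewrite nsort3 !card_ord !eqE /=; lia.
- case=> [[[i|i]|i]|] [[[j|j]|j]|] //=; try by [rewrite !ord1 | move=> [->]].
by case=> [[i|i]|i] [[[j|j]|j]|] //=; rewrite ?mx_relE.
Qed.

Lemma giso_G2 m : giso (G2 \cup mK2 m \cup K1) (kind_graph KL (3 + 3 + m) 3 3).
Proof.
apply: giso_trans (giso_gunionl _ (giso_gunionl _ (giso_block_mx _ _ _ _))) _.
apply: giso_trans (giso_mK2_K1 _ _) _.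
pose h (u : option ('I_3 + 'I_3 + 'I_m)) : option ('I_3 + 'I_3 + 'I_m) := u.
apply: (giso_kind_graph (s := @sort3 _ _ _) (h := h)).
- by rewrite !card_sum !card_ord.
- by rewrite card_option !card_sum !card_ord.
- by rewrite nsort3 !card_ord !eqE /=; lia.
- by rewrite nsort3 !card_ord !eqE /=; lia.
- by [].
by case=> [[i|i]|i] [[[j|j]|j]|] //=; rewrite ?mx_relE.
Qed.

Lemma giso_G3 m : giso (G3 \cup mK2 m) (kind_graph KH (4 + 1 + m) 4 1).
Proof.
apply: giso_trans (giso_trans (giso_gunionl _ (giso_block_mx _ _ _ _)) (giso_mK2 _ _)) _.
pose h (u : option ('I_4 + 'I_1 + 'I_m)) : 'I_4 + 'I_2 + 'I_m :=
  match u with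
  | Some (inl (inl i)) => inl (inl i)
  | Some (inl (inr i)) => inl (inr ord0)
  | Some (inr i) => inr i
  | None => inl (inr ord_max)
  end.
apply: (giso_kind_graph (s := @sort3 _ _ _) (h := h)).
- by rewrite !card_sum !card_ord.
- by rewrite !card_sum !card_ord; lia.
- by rewrite nsort3 !card_ord !eqE /=; lia.
- by rewrite nsort3 !card_ord !eqE /=; lia.
- case=> [[[i|i]|i]|] [[[j|j]|j]|] //=; try by [rewrite !ord1 | move=> [->]].
by case=> [[i|i]|i] [[[j|j]|j]|] //=; rewrite ?mx_relE ?ord1.
Qed.

Lemma giso_G4 m : giso (G4 \cup mK2 m) (kind_graph KH (3 + 2 + m) 3 2).
Proof.
apply: giso_trans (giso_trans (giso_gunionl _ (giso_block_mx _ _ _ _)) (giso_mK2 _ _)) _.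
pose h (u : option ('I_3 + 'I_2 + 'I_m)) : 'I_3 + 'I_(2 + 1) + 'I_m :=
  match u with
  | Some (inl (inl i)) => inl (inl i)
  | Some (inl (inr i)) => inl (inr (lshift 1 i))
  | Some (inr i) => inr i
  | None => inl (inr (rshift 2 ord0))
  end.
apply: (giso_kind_graph (s := @sort3 _ _ _) (h := h)).
- by rewrite !card_sum !card_ord.
- by rewrite !card_sum !card_ord; lia.
- by rewrite nsort3 !card_ord !eqE /=; lia.
- by rewrite nsort3 !card_ord !eqE /=; lia.
- case=> [[[i|i]|i]|] [[[j|j]|j]|] //= []; try by [move=> -> | move=> /val_inj->].
    by move=> e; have := ltn_ord i; rewrite e.
  by move=> e; have := ltn_ord j; rewrite -e.
by case=> [[i|i]|i] [[[j|j]|j]|] //=; rewrite ?mx_relE.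
Qed.

(** The subdividing vertices are the k rows, of size 2, so the sides must be swapped; the centre of
    the star is the column [None]. *)
Lemma giso_calS k : giso (calS (2 * k + 1)) (kind_graph KR k 0 k).
Proof.
rewrite /calS /subdivision.
have -> : (2 * k + 1)./2 = k by lia.
apply: giso_trans (giso_bip_swap _) _.
have edgeP (j : 'I_k) : [exists x : complete_bip 1 k, exists y,
    adj x y && ([set inl ord0; inr j] == [set x; y])].
  by apply/existsP; exists (inl ord0); apply/existsP; exists (inr j); rewrite eqxx.
pose E (j : 'I_k) : edge (complete_bip 1 k) := Sub [set inl ord0; inr j] (edgeP j).
have Einr i j : (inr i \in val (E j)) = (i == j).
  by rewrite SubK !inE.
have Einl i j : (inl i \in val (E j)) = true by rewrite SubK !inE ord1 eqxx.
have Einj : injective E.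
  by move=> i j eE; apply/eqP; rewrite -Einr -eE Einr eqxx.
have Esurj (e : edge (complete_bip 1 k)) : exists j, E j = e.
  case: e => e eP; have /existsP[x /existsP[y /andP[xy /eqP ee]]] := eP.
  case: x y xy ee => [i|j] [i'|j'] //= _ ee; [exists j'|exists j]; apply: val_inj.
    by rewrite SubK /= ee (ord1 i).
  by rewrite SubK /= ee setUC (ord1 i').
have [F FK] := fin_all_exists Esurj.
have EK : cancel E F by move=> j; apply: Einj; rewrite FK.
apply: giso_sym; apply: giso_trans (giso_bip (r := fun j (x : 'I_1 + 'I_k) => x \in val (E j))
    (f := E) (h := id) _ _ _) => //; last 2 first.
- by exists F.
- by exists id.
apply: giso_sym.
pose h (u : option 'I_k) : 'I_1 + 'I_k := if u is Some j then inr j else inl ord0.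
apply: (giso_kind_graph (s := fun=> Some false) (h := h)).
- by rewrite card_ord.
- by rewrite card_sum !card_ord.
- by rewrite nsort_const.
- by rewrite nsort_const card_ord mul1n.
- by case=> [i|] [j|] //= [->].
by move=> i [j|] /=; rewrite ?Einr ?Einl // eq_sym.
Qed.

(** * Degrees *)

(** Which degrees occur is enough to tell apart all candidates that are not isomorphic. *)
Definition has_deg (G : sgraph) d := exists v : G, #|[set w | adj v w]| = d.

Lemma giso_has_deg G H d : giso G H -> has_deg G d -> has_deg H d.
Proof.
case=> f fbij fadj [v <-]; exists (f v).
rewrite -(card_imset _ (bij_inj fbij)); apply: eq_card => w; rewrite inE.
have [g fK gK] := fbij; rewrite -{1}(gK w) fadj.
apply/idP/imsetP => [vw|[w' + ->]]; last by rewrite inE fK.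
by exists (g w); rewrite ?inE ?gK.
Qed.

Section KindDegrees.

Variables (f : kind) (k p q : nat).
Hypothesis lek : p + q <= k.

Let G := kind_graph f k p q.
Let s := @sortk p q k.

Let card_inlr (X Y : finType) (P : pred Y) :
  #|[set u : X + Y | if u is inr y then P y else false]| = #|[set y | P y]|.
Proof.
rewrite -(card_imset (mem [set y | P y]) (@inr_inj X Y)); apply: eq_card => -[x|y].
  by rewrite inE; apply/esym/negbTE/imsetP => -[].
by rewrite inE mem_imset ?inE//; apply: inr_inj.
Qed.

Let card_inrl (X Y : finType) (P : pred X) :
  #|[set u : X + Y | if u is inl y then P y else false]| = #|[set y | P y]|.
Proof.
rewrite -(card_imset (mem [set y | P y]) (@inl_inj X Y)); apply: eq_card => -[x|y].
  by rewrite inE mem_imset ?inE//; apply: inl_inj.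
by rewrite inE; apply/esym/negbTE/imsetP => -[].
Qed.

Lemma deg_kind_row (a : 'I_k) :
  #|[set w | @adj G (inl a) w]| = rowcard f p q (s a).
Proof.
have [np nq _] := nsort_sortk lek.
have := card_kind_row f s a; rewrite /s np nq => <-.
apply: etrans (card_inlr 'I_k (kind_rel f s a)).
by apply: eq_card => -[x|y]; rewrite !inE.
Qed.

Lemma deg_kind_col (b : option 'I_k) :
  #|[set w | @adj G (inr b) w]| = colcard f p q (omap s b).
Proof.
have [np nq _] := nsort_sortk lek.
have := card_kind_col f s b; rewrite /s np nq => <-.
apply: etrans (card_inrl (option 'I_k) (fun a => kind_rel f s a b)).
by apply: eq_card => -[x|y]; rewrite !inE.
Qed.

Lemma has_deg_kindP d : has_deg G d ->
  d = 1 \/ d = colcard f p q None \/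
  (0 < p /\ (d = rowcard f p q (Some true) \/ d = colcard f p q (Some (Some true)))) \/
  (0 < q /\ (d = rowcard f p q (Some false) \/ d = colcard f p q (Some (Some false)))).
Proof.
have sgt0 x a : s a = Some x -> 0 < if x then p else q.
  move=> sa; have := nsort_gt0 s a; have [np nq _] := nsort_sortk lek.
  by rewrite sa; case: x {sa}; rewrite /s ?np ?nq.
case=> -[a|[a|]] <-; rewrite (deg_kind_row, deg_kind_col).
- by case sa: (s a) => [x|]; [have := sgt0 _ _ sa; case: x {sa}|]; tauto.
- by rewrite /=; case sa: (s a) => [x|]; [have := sgt0 _ _ sa; case: x {sa}|]; tauto.
by tauto.
Qed.

Lemma has_deg_none : has_deg G (colcard f p q None).
Proof. by exists (inr None); rewrite deg_kind_col. Qed.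

Lemma has_deg_big : 0 < p -> has_deg G (rowcard f p q (Some true)).
Proof.
move=> p_gt0; have k_gt0 : 0 < k by lia.
by exists (inl (Ordinal k_gt0)); rewrite deg_kind_row /s /sortk /= p_gt0.
Qed.

Lemma has_deg_small : 0 < q -> has_deg G (colcard f p q (Some (Some false))).
Proof.
move=> q_gt0; have ltpk : p < k by lia.
exists (inr (Some (Ordinal ltpk))); rewrite deg_kind_col /s /sortk /= ltnn.
by rewrite -[X in X < _]addn0 ltn_add2l q_gt0.
Qed.

End KindDegrees.

(** The centre of the star has degree k, and all degrees of a candidate with a big row are smaller.
    The exception is KH with p = 2, where k = 2. *)
Lemma kind_not_star f k p q : 0 < p -> k <> 2 -> kind_params f k p q ->
  ~ giso (kind_graph f k p q) (kind_graph KR k 0 k).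
Proof.
move=> p_gt0 k2 [lek par] /giso_sym/giso_has_deg.
have k_gt0 : 0 < k by lia.
move/(_ _ (@has_deg_none KR k 0 k (leqnn k))) => /(has_deg_kindP lek) /=.
rewrite add0n => deg.
case: f par deg => /= par deg.
- case: par; lia.
- lia.
- case: par => [[q0 ek]|]; last by lia.
  have : 2 < p by nia.
  nia.
- case: par => [[q0 ek]|]; last by lia.
  nia.
lia.
Qed.

(** KL has an isolated vertex, whereas R and Q with a big row have none. *)
Lemma kind_KL_neq_KRQ f k p q p' : f = KR \/ f = KQ -> 0 < p' -> kind_params KL k p q ->
  p' + 3 <= k -> ~ giso (kind_graph KL k p q) (kind_graph f k p' 3).
Proof.
move=> ff p_gt0 [lek _] lek' /giso_has_deg/(_ (has_deg_none KL lek)).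
move=> /(has_deg_kindP lek') /=; case: ff => -> /=; lia.
Qed.

(* The degree p+3 of KR does not occur in KQ unless p = 2, when p+1 does not. *)
Lemma kind_KR_neq_KQ k p : 0 < p -> p + 3 <= k ->
  ~ giso (kind_graph KR k p 3) (kind_graph KQ k p 3).
Proof.
move=> p_gt0 lek iso.
have /= /(giso_has_deg iso)/(has_deg_kindP lek)/= d3 := has_deg_none KR lek.
have /= /(giso_has_deg iso)/(has_deg_kindP lek)/= d1 := @has_deg_small KR k p 3 lek isT.
lia.
Qed.

(** J_2 - I_2 becomes I_2 when its columns are reversed. *)
Lemma kind_KH2_star : giso (kind_graph KH 2 2 0) (kind_graph KR 2 0 2).
Proof.
apply: (giso_bip (f := id) (h := omap (@rev_ord 2))); first by exists id.
  by exists (omap (@rev_ord 2)) => -[a|] //=; rewrite rev_ordK.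
by move=> [[|[|?]] ?] [[[|[|?]] ?]|].
Qed.

(** Both have the matrix J_3 - I_3 with a zero column; its rows count as small on the left and as
    big on the right. *)
Lemma kind_KQ3_KL3 : giso (kind_graph KQ 3 0 3) (kind_graph KL 3 3 0).
Proof.
apply: (giso_bip (f := id) (h := id)); [by exists id | by exists id |].
by move=> [[|[|[|?]]] ?] [[[|[|[|?]]] ?]|].
Qed.

(** * Cospectral mates *)

Lemma star_kind_params k : kind_params KR k 0 k.
Proof. by split; [rewrite add0n | left]. Qed.

Lemma kind_char_poly f k p q G : 0 < k -> kind_params f k p q ->
  giso G (kind_graph f k p q) ->
  char_poly (adjmx G) = ('X * (gram_poly k \Po 'X^2))%R.
Proof.
move=> k_gt0 par /giso_char_poly->; apply: good_char_poly => //.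
exact: kind_good.
Qed.

Lemma card_calS k : #|calS (2 * k + 1)| = 2 * k + 1.
Proof.
have [f /bij_eq_card-> _] := giso_calS k.
by rewrite card_sum card_option card_ord; lia.
Qed.

Lemma calS_mateP k H : 0 < k -> mate (calS (2 * k + 1)) H ->
  exists f p q, kind_params f k p q /\ giso H (kind_graph f k p q).
Proof.
move=> k_gt0 [/cospectralE cSH _].
have cH := kind_char_poly k_gt0 (star_kind_params k) (giso_calS k); rewrite cSH in cH.
have oH : #|H| = 2 * k + 1.
  by apply: succn_inj; rewrite -(size_char_poly (adjmx H)) -cSH size_char_poly card_calS.
have [A [B [r r_good Hr]]] := cospectral_good k_gt0 cH oH.
have [f [p [q [par rf]]]] := good_classification k_gt0 r_good.
by exists f, p, q; split=> //; apply: giso_trans rf.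
Qed.

Lemma calS_DS k : 0 < k ->
  (forall f p q, kind_params f k p q -> giso (kind_graph f k p q) (kind_graph KR k 0 k)) ->
  DS (calS (2 * k + 1)).
Proof.
move=> k_gt0 only_star [H mH]; have [f [p [q [par Hf]]]] := calS_mateP k_gt0 mH.
case: mH => _; apply; apply: giso_trans Hf _.
by apply: giso_trans (only_star _ _ _ par) _; apply/giso_sym/giso_calS.
Qed.

(** Each proposed mate is matched with a parameter triple in [Ks]. The condition 0 < p keeps it from
    being the star, and what remains is to solve [kind_params] for the given k and to compare the
    listed candidates. *)
Lemma calS_exact_mates k (Hs : seq sgraph) (Ks : seq (kind * nat * nat)) :
  let K i := let: (f, p, q) := nth (KR, 0, k) Ks i in kind_graph f k p q in
  let par i := let: (f, p, q) := nth (KR, 0, k) Ks i in 0 < p /\ kind_params f k p q in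
  0 < k -> k <> 2 -> size Hs = size Ks ->
  (forall i, i < size Ks -> giso (nth (calS (2 * k + 1)) Hs i) (K i)) ->
  (forall i, i < size Ks -> par i) ->
  (forall i j, i < j -> j < size Ks -> ~ giso (K i) (K j)) ->
  (forall f p q, kind_params f k p q -> giso (kind_graph f k p q) (kind_graph KR k 0 k) \/
     exists2 i, i < size Ks & giso (kind_graph f k p q) (K i)) ->
  exact_mates (calS (2 * k + 1)) Hs.
Proof.
move=> K par k_gt0 k2 eqs HK Kpar Kneq Kall; split.
- move=> i; rewrite eqs => ltis; have := HK i ltis; have := Kpar i ltis.
  rewrite /par /K; case: (nth _ Ks i) => [[f p] q] [p_gt0 pf] Hf; split.
    apply/cospectralE; rewrite (kind_char_poly k_gt0 pf Hf).
    exact: kind_char_poly k_gt0 (star_kind_params k) (giso_calS k).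
  move=> HS; apply: (kind_not_star p_gt0 k2 pf).
  exact: giso_trans (giso_sym Hf) (giso_trans HS (giso_calS k)).
- move=> i j ltij; rewrite eqs => ltjs HH; apply: (Kneq i j) => //.
  apply: giso_trans (giso_sym (HK i (ltn_trans ltij ltjs))) _.
  exact: giso_trans HH (HK j ltjs).
move=> H mH; have [f [p [q [pf Hf]]]] := calS_mateP k_gt0 mH.
have [star|[i lti Ki]] := Kall f p q pf.
  case: mH => _ []; apply: giso_trans Hf (giso_trans star _).
  exact/giso_sym/giso_calS.
exists i; rewrite ?eqs//; apply: giso_trans Hf (giso_trans Ki _).
exact/giso_sym/HK.
Qed.

(** The map n -> n (n - c) is strictly increasing where it is positive; with c = 1 and c = 2 it
    recovers p from k for KH and KL. *)
Lemma mul_subr_inj c n m : 0 < n * (n - c) -> n * (n - c) = m * (m - c) -> n = m.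
Proof. by move=> n_gt0 e; case: (ltngtP n m) => // lt; nia. Qed.

(** The star is split off because it is the solution available for every k. *)
Lemma kind_params_cases f k p q : kind_params f k p q ->
  (f, p, q) = (KR, 0, k) \/
  [\/ (f = KR \/ f = KQ) /\ q = 3 /\ k = 4 * p + 3,
      f = KH /\ ((q = 0 /\ k = p * (p - 1)) \/ (p = 3 /\ q = 2 /\ k = 14)
        \/ (p = 4 /\ q = 1 /\ k = 17)),
      f = KL /\ ((q = 0 /\ k = p * (p - 2)) \/ (p = 3 /\ q = 3 /\ k = 15))
    | f = KG /\ p = 1 /\ q = 4 /\ k = 8].
Proof.
case: f => [] [_] => [[[-> ->]|[-> ->]]||||]; [by left| | | | |]; right;
  [apply: Or41 | apply: Or41 | apply: Or42 | apply: Or43 | apply: Or44]; tauto.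
Qed.

Theorem corollary12 :
  (forall k : nat, 0 < k -> ~ exceptional k -> DS (calS (2 * k + 1))) /\
  (* (a) *)
  exact_mates (calS 17) [:: calL 4 \cup mK2 4 \cup K1; G1 \cup mK2 3 \cup K1] /\
  (* (b) *)
  exact_mates (calS 29) [:: G4 \cup mK2 9] /\
  (* (c) *)
  exact_mates (calS 31)
    [:: G2 \cup mK2 9 \cup K1; calL 5 \cup mK2 10 \cup K1;
        calR 13 \cup mK2 9; calQ 13 \cup mK2 9] /\
  (* (d) *)
  exact_mates (calS 35) [:: G3 \cup mK2 12] /\
  (* (e) *)
  (forall k l : nat, 0 < k -> k = 4 * l + 3 ->
     ~ (exists t : nat, l = t ^ 2 - 1) ->
     exact_mates (calS (2 * k + 1))
       [:: calR (2 * l + 7) \cup mK2 (3 * l);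
           calQ (2 * l + 7) \cup mK2 (3 * l)]) /\
  (* (f); k = 3 is degenerate: there calR 7 is isomorphic to calS 7 and calQ 7
     to calL 3 \cup K1, so that only one mate is left *)
  (forall k l t : nat, 0 < k -> k = l ^ 2 - 1 -> l = 2 * t -> k <> 15 ->
     k <> 3 ->
     exact_mates (calS (2 * k + 1))
       [:: calL (l + 1) \cup mK2 (k - l - 1) \cup K1;
           calR (2 * t ^ 2 + 5) \cup mK2 (3 * (t ^ 2 - 1));
           calQ (2 * t ^ 2 + 5) \cup mK2 (3 * (t ^ 2 - 1))]) /\
  exact_mates (calS 7) [:: calL 3 \cup K1] /\
  (* (g) *)
  (forall k l : nat, 0 < k -> k = l ^ 2 - 1 -> odd l -> k <> 8 ->
     exact_mates (calS (2 * k + 1))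
       [:: calL (l + 1) \cup mK2 (k - l - 1) \cup K1]) /\
  (* (h); k = 2 is degenerate: there calH 2 is isomorphic to calS 5 *)
  (forall k l : nat, 0 < k -> k = l ^ 2 - l -> k <> 2 ->
     exact_mates (calS (2 * k + 1)) [:: calH l \cup mK2 (k - l)]) /\
  DS (calS 5).
Proof.
split.
  move=> k k_gt0 nex; apply: calS_DS => // f p q /kind_params_cases[[-> -> ->]|cases].
    exact: giso_refl.
  case: nex; case: cases =>
      [[_ [_ ek]]|[_ [[_ ek]|[[_ [_ ek]]|[_ [_ ek]]]]]|[_ [[_ ek]|[_ [_ ek]]]]|[_ [_ [_ ek]]]].
  - by apply: Or41; exists p.
  - by apply: Or43; exists p; rewrite ek mulnBr muln1 mulnn.
  - by apply: Or44; left.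
  - by apply: Or44; right.
  (* Here p (p - 2) = (p - 1)^2 - 1; the two sporadic values that follow are 15 = 4^2 - 1 and 8 =
     3^2 - 1. *)
  - by apply: Or42; exists (p - 1); rewrite ek -mulnn; nia.
  - by apply: Or42; exists 4.
  - by apply: Or42; exists 3.
split.
  apply: (@calS_exact_mates 8 _ [:: (KL, 4, 0); (KG, 1, 4)]) => //.
  - case=> [|[|i]] //= _; [exact: giso_calL_mK2 4 4 | exact: giso_G1 3].
  - by case=> [|[|i]] //= _; do ?split=> //; left.
  - case=> [|[|i]] [|[|j]] //= _ _ /giso_sym/giso_has_deg.
    (* The big row of G_1 has degree 5, while the degrees on the other side are at most 3. *)
    move/(_ _ (@has_deg_big KG 8 1 4 isT isT))/has_deg_kindP => /(_ isT) /=; lia.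
  move=> f p q /kind_params_cases[[-> -> ->]|cases]; first by left; apply: giso_refl.
  right; case: cases =>
      [[_ [_ ek]]|[_ [[_ ek]|[[_ [_ ek]]|[_ [_ ek]]]]]|[-> [[-> ek]|[_ [_ ek]]]]|[-> [-> [-> _]]]] //.
  - by lia.
  - by case: (leqP p 3); nia.
  - by exists 0 => //; rewrite (@mul_subr_inj 2 p 4) -?ek//; apply: giso_refl.
  by exists 1 => //; apply: giso_refl.
split.
  apply: (@calS_exact_mates 14 _ [:: (KH, 3, 2)]) => //.
  - by case=> [|i] //= _; exact: giso_G4 9.
  - by case=> [|i] //= _; split=> //; split=> //; right; left.
  - by case=> [|i] [|j].
  move=> f p q /kind_params_cases[[-> -> ->]|cases]; first by left; apply: giso_refl.
  right; case: cases =>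
      [[_ [_ ek]]|[-> [[_ ek]|[[-> [-> _]]|[_ [_ ek]]]]]|[_ [[_ ek]|[_ [_ ek]]]]|[_ [_ [_ ek]]]] //.
  - by lia.
  - by case: (leqP p 4); nia.
  - by exists 0 => //; apply: giso_refl.
  by case: (leqP p 4); nia.
split.
  apply: (@calS_exact_mates 15 _ [:: (KL, 3, 3); (KL, 5, 0); (KR, 3, 3); (KQ, 3, 3)]) => //.
  - case=> [|[|[|[|i]]]] //= _; [exact: giso_G2 9 | exact: giso_calL_mK2 5 10
      | exact: giso_calR 13 9 | exact: giso_calQ 13 9].
  - by case=> [|[|[|[|i]]]] //= _; do ?split=> //; [right|left|right].
  - case=> [|[|[|[|i]]]] [|[|[|[|j]]]] //= _ _.
    + move=> iso; have := giso_has_deg iso (@has_deg_big KL 15 3 3 isT isT).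
      by move/(@has_deg_kindP KL 15 5 0 isT) => /=; lia.
    + by apply: kind_KL_neq_KRQ; [left| |split=> //; right|].
    + by apply: kind_KL_neq_KRQ; [right| |split=> //; right|].
    + by apply: kind_KL_neq_KRQ; [left| |split=> //; left|].
    + by apply: kind_KL_neq_KRQ; [right| |split=> //; left|].
    + exact: kind_KR_neq_KQ.
  move=> f p q /kind_params_cases[[-> -> ->]|cases]; first by left; apply: giso_refl.
  right; case: cases =>
      [[ef [-> ek]]|[_ [[_ ek]|[[_ [_ ek]]|[_ [_ ek]]]]]|[-> [[-> ek]|[-> [-> _]]]]|[_ [_ [_ ek]]]] //.
  - have -> : p = 3 by lia.
    by case: ef => ->; [exists 2 | exists 3] => //; apply: giso_refl.
  - by case: (leqP p 4); nia.
  - by exists 1 => //; rewrite (@mul_subr_inj 2 p 5) -?ek//; apply: giso_refl.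
  by exists 0 => //; apply: giso_refl.
split.
  apply: (@calS_exact_mates 17 _ [:: (KH, 4, 1)]) => //.
  - by case=> [|i] //= _; exact: giso_G3 12.
  - by case=> [|i] //= _; split=> //; split=> //; right; right.
  - by case=> [|i] [|j].
  move=> f p q /kind_params_cases[[-> -> ->]|cases]; first by left; apply: giso_refl.
  right; case: cases =>
      [[_ [_ ek]]|[-> [[_ ek]|[[_ [_ ek]]|[-> [-> _]]]]]|[_ [[_ ek]|[_ [_ ek]]]]|[_ [_ [_ ek]]]] //.
  - by lia.
  - by case: (leqP p 4); nia.
  - by exists 0 => //; apply: giso_refl.
  by case: (leqP p 5); nia.
split.
  move=> k l k_gt0 ek nl; have l_gt0 : 0 < l.
    (* The value l = 0 is excluded as 1^2 - 1; it is the degenerate k = 3. *)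
    by rewrite lt0n; apply/eqP => l0; case: nl; exists 1.
  apply: (@calS_exact_mates k _ [:: (KR, l, 3); (KQ, l, 3)]) => //; first by lia.
  - have en : (2 * l + 7)./2 - 3 = l by lia.
    have ek' : k = l + 3 + 3 * l by lia.
    case=> [|[|i]] //= _; rewrite ek'.
      by have := giso_calR (2 * l + 7) (3 * l); rewrite en.
    by have := giso_calQ (2 * l + 7) (3 * l); rewrite en.
  - by case=> [|[|i]] //= _; split=> //; split; [lia | right | lia | ].
  - by case=> [|[|i]] [|[|j]] //= _ _; apply: kind_KR_neq_KQ; lia.
  move=> f p q /kind_params_cases[[-> -> ->]|cases]; first by left; apply: giso_refl.
  right; case: cases =>
      [[ef [-> ek']]|[_ [[_ ek']|[[_ [_ ek']]|[_ [_ ek']]]]]|[_ [[_ ek']|[_ [_ ek']]]]|[_ [_ [_ ek']]]].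
  - have -> : p = l by lia.
    by case: ef => ->; [exists 0 | exists 1] => //; apply: giso_refl.
  (* KH would make k = p (p - 1) even. *)
  - have : ~~ odd k by rewrite ek' oddM; case: p {ek'} => [|p] //=; rewrite subn1 andNb.
    by rewrite ek oddD oddM.
  - by lia.
  - by lia.
  (* With p = 2 t + 1, p (p - 2) = 4 t^2 - 1 = 4 l + 3, so l = t^2 - 1. *)
  - case: nl; have p1 : odd p.
      have : odd k by rewrite ek oddD oddM.
      by rewrite ek' oddM => /andP[].
    have [t et] : exists t, p = 2 * t + 1 by exists (p./2); lia.
    by exists t; rewrite -mulnn; nia.
  - by case: nl; exists 2; lia.
  by lia.
split.
  move=> k l t k_gt0 ek el k15 k3; rewrite -!mulnn in ek *.
  have t_gt1 : 1 < t by case: t el => [|[|t]] el //; nia.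
  (* That is 4 (t^2 - 1) + 3, whence p = t^2 - 1 for R and Q. *)
  have ek4 : k = 4 * (t * t) - 1 by nia.
  apply: (@calS_exact_mates k _ [:: (KL, l + 1, 0); (KR, t * t - 1, 3); (KQ, t * t - 1, 3)])
    => //.
  - by lia.
  - have en : (2 * (t * t) + 5)./2 - 3 = t * t - 1 by lia.
    have ekR : k = t * t - 1 + 3 + 3 * (t * t - 1) by nia.
    case=> [|[|[|i]]] //= _.
    + have {2}-> : k = l + 1 + (k - l - 1) by nia.
      exact: giso_calL_mK2.
    + rewrite ekR.
      by have := giso_calR (2 * (t * t) + 5) (3 * (t * t - 1)); rewrite en.
    + rewrite ekR.
      by have := giso_calQ (2 * (t * t) + 5) (3 * (t * t - 1)); rewrite en.
  - case=> [|[|[|i]]] //= _.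
    + by split; [lia | split; [nia | left; split=> //; nia]].
    + by split; [nia | split; [nia | right; nia]].
    + by split; [nia | split; nia].
  - have kKL : kind_params KL k (l + 1) 0 by split; [nia | left; split=> //; nia].
    case=> [|[|[|i]]] [|[|[|j]]] //= _ _.
    + by apply: kind_KL_neq_KRQ kKL _; [left | nia | nia].
    + by apply: kind_KL_neq_KRQ kKL _; [right | nia | nia].
    + by apply: kind_KR_neq_KQ; nia.
  move=> f p q /kind_params_cases[[-> -> ->]|cases]; first by left; apply: giso_refl.
  right; case: cases =>
      [[ef [-> ek']]|[_ [[_ ek']|[[_ [_ ek']]|[_ [_ ek']]]]]|[-> [[-> ek']|[_ [_ ek']]]]|[_ [_ [_ ek']]]].
  - have -> : p = t * t - 1 by lia.
    by case: ef => ->; [exists 1 | exists 2] => //; apply: giso_refl.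
  - have : ~~ odd k by rewrite ek' oddM; case: p {ek'} => [|p] //=; rewrite subn1 andNb.
    by lia.
  - by lia.
  - by lia.
  - exists 0 => //; rewrite (@mul_subr_inj 2 p (l + 1)) -?ek'//; first exact: giso_refl.
    by rewrite ek; nia.
  - by lia.
  by lia.
split.
  apply: (@calS_exact_mates 3 _ [:: (KL, 3, 0)]) => //.
  - case=> [|i] //= _; apply: giso_trans (giso_calL_mK2 3 0).
    exact/giso_gunionl/giso_sym/giso_mK2_0.
  - by case=> [|i] //= _; split=> //; split=> //; left.
  - by case=> [|i] [|j].
  move=> f p q /kind_params_cases[[-> -> ->]|cases]; first by left; apply: giso_refl.
  case: cases =>
      [[ef [-> ek]]|[_ [[_ ek]|[[_ [_ ek]]|[_ [_ ek]]]]]|[-> [[-> ek]|[_ [_ ek]]]]|[_ [_ [_ ek]]]] //.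
  - have -> : p = 0 by lia.
    case: ef => ->; first by left; apply: giso_refl.
    by right; exists 0 => //; apply: kind_KQ3_KL3.
  - by case: (leqP p 2); nia.
  - by right; exists 0 => //; rewrite (@mul_subr_inj 2 p 3) -?ek//; apply: giso_refl.
split.
  move=> k l k_gt0 ek ol k8; rewrite -mulnn in ek.
  (* For odd l, l = 1 would give k = 0 and l = 3 the excluded k = 8. *)
  have l_gt4 : 4 < l by case: l ek ol => [|[|[|[|[|l]]]]] //=; lia.
  apply: (@calS_exact_mates k _ [:: (KL, l + 1, 0)]) => //.
  - by nia.
  - case=> [|i] //= _; have {2}-> : k = l + 1 + (k - l - 1) by nia.
    exact: giso_calL_mK2.
  - by case=> [|i] //= _; split; [lia | split; [nia | left; split=> //; nia]].
  - by case=> [|i] [|j].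
  move=> f p q /kind_params_cases[[-> -> ->]|cases]; first by left; apply: giso_refl.
  right; case: cases =>
      [[_ [_ ek']]|[_ [[_ ek']|[[_ [_ ek']]|[_ [_ ek']]]]]|[-> [[-> ek']|[_ [_ ek']]]]|[_ [_ [_ ek']]]].
  (* R and Q need k odd, but l^2 - 1 is even for odd l. *)
  - have : odd k by rewrite ek' oddD oddM.
    by rewrite ek oddB ?oddM ?ol//; nia.
  (* The number l^2 - 1 lies strictly between the consecutive values l (l - 1) and (l + 1) l of p (p
     - 1). *)
  - by case: (leqP p l) => lpl; nia.
  - by case: (leqP l 4) => ?; nia.
  - by nia.
  - exists 0 => //; rewrite (@mul_subr_inj 2 p (l + 1)) -?ek'//; first exact: giso_refl.
    by rewrite ek; nia.
  - by nia.
  by nia.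
split.
  move=> k l k_gt0 ek k2; rewrite -mulnn in ek.
  have l_gt2 : 2 < l by case: l ek => [|[|[|l]]] //=; lia.
  apply: (@calS_exact_mates k _ [:: (KH, l, 0)]) => //.
  - case=> [|i] //= _; have {2}-> : k = l + (k - l) by nia.
    exact: giso_calH_mK2.
  - case=> [|i] //= _; split; [lia | split; [nia | left; split=> //]].
    by rewrite mulnBr muln1.
  - by case=> [|i] [|j].
  have nk : ~~ odd k by rewrite ek oddB ?oddM ?andbb ?addbb//; nia.
  move=> f p q /kind_params_cases[[-> -> ->]|cases]; first by left; apply: giso_refl.
  right; case: cases =>
      [[_ [_ ek']]|[-> [[-> ek']|[[_ [_ ek']]|[_ [_ ek']]]]]|[_ [[_ ek']|[_ [_ ek']]]]|[_ [_ [_ ek']]]].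
  - by move: nk; rewrite ek' oddD oddM.
  - exists 0 => //; rewrite (@mul_subr_inj 1 p l) -?ek'//; first exact: giso_refl.
    by rewrite mulnBr muln1.
  - by case: (leqP l 4) => ?; nia.
  - by rewrite ek' in nk.
  (* The number l (l - 1) lies strictly between the consecutive values l (l - 2) and (l + 1) (l - 1)
     of p (p - 2). *)
  - by case: (leqP p l) => ?; nia.
  - by rewrite ek' in nk.
  by case: (leqP l 3) => ?; nia.
apply: (@calS_DS 2) => // f p q /kind_params_cases[[-> -> ->]|cases]; first exact: giso_refl.
case: cases =>
      [[_ [_ ek]]|[-> [[-> ek]|[[_ [_ ek]]|[_ [_ ek]]]]]|[_ [[_ ek]|[_ [_ ek]]]]|[_ [_ [_ ek]]]] //.
- by lia.
- by rewrite (@mul_subr_inj 1 p 2) -?ek//; apply: kind_KH2_star.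
by case: (leqP p 2); nia.
Qed.
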